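(* Let $\theta\in\mathbb{R}$, let $n$ be a positive integer, let $\ell:\mathcal{A}(SU(2))\to\mathcal{A}(S^7_{\theta'})\otimes\mathcal{A}(S^7_{\theta'})$ be the linear map defined recursively in the context, and let $\omega(h)=\ell(h)-\epsilon(h)\,1\otimes1\in\Omega^1_{\mathrm{un}}(\mathcal{A}(S^7_{\theta'}))$. Then, on the quotient $\Omega^1(S^7_{\theta'})$ of $\Omega^1_{\mathrm{un}}(\mathcal{A}(S^7_{\theta'}))$, $\omega$ coincides with the connection one-form of the Grassmannian connection $p_{(n)}\circ\mathrm{d}$: for all $k,l=1,\dots,n+1$, $$\pi(\omega(e^{(n)}_{kl}))=A^{(n)}_{kl}=\langle\phi_k|\mathrm{d}\phi_l\rangle,$$ where $\pi:\Omega_{\mathrm{un}}(\mathcal{A}(S^7_{\theta'}))\to\Omega(S^7_{\theta'})$ is the quotient map and $e^{(n)}_{kl}\in\mathcal{A}(SU(2))$ are the matrix coefficients of the representation $\rho_{(n)}$ on $V^{(n)}=\mathrm{Sym}^n(\mathbb{C}^2)$.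
   Context: Let $\lambda=e^{2\pi i\theta}$, $\mu=\sqrt\lambda=e^{\pi i\theta}$. $\mathcal{A}(S^7_{\theta'})$ is the unital complex $*$-algebra generated by $z^1,\dots,z^4$ and $\bar z^i=(z^i)^*$, with relations $z^iz^j=\lambda'^{ij}z^jz^i$, $\bar z^iz^j=\lambda'^{ji}z^j\bar z^i$, $\bar z^i\bar z^j=\lambda'^{ij}\bar z^j\bar z^i$ and $\sum_iz^i\bar z^i=1$, where $\lambda'^{ij}=1$ for $i,j\in\{1,2\}$ or $i,j\in\{3,4\}$, $\lambda'^{ij}=\mu$ for $i\in\{1,2\},j\in\{3,4\}$, $\lambda'^{ij}=\bar\mu$ for $i\in\{3,4\},j\in\{1,2\}$. Calculi. $\Omega_{\mathrm{un}}(A)$ is the universal differential algebra of $A$, with $\Omega^1_{\mathrm{un}}A=\ker(A\otimes A\to A)$ and $\delta a=1\otimes a-a\otimes1$. $\Omega(S^7_{\theta'})$ is the graded differential $*$-algebra, with differential $\mathrm{d}$, generated by $z^i,\bar z^i$ in degree $0$ and $dz^i,d\bar z^i$ in degree $1$, with the relations of $\mathcal{A}(S^7_{\theta'})$, the relations $z^idz^j=\lambda'^{ij}dz^jz^i$, $\bar z^idz^j=\lambda'^{ji}dz^j\bar z^i$, $\bar z^id\bar z^j=\lambda'^{ij}d\bar z^j\bar z^i$, $dz^idz^j+\lambda'^{ij}dz^jdz^i=0$, $d\bar z^idz^j+\lambda'^{ji}dz^jd\bar z^i=0$, $d\bar z^id\bar z^j+\lambda'^{ij}d\bar z^jd\bar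 z^i=0$, their adjoints, and $\mathrm{d}(\sum_iz^i\bar z^i)=0$. The map $\pi$ is the identity in degree $0$ and sends $\delta$ to $\mathrm{d}$. Kets. $\langle\xi|\eta\rangle=\sum_j\xi_j^*\eta_j$, $\langle\xi|\mathrm{d}\eta\rangle=\sum_j\xi_j^*\,\mathrm{d}\eta_j$, and $(|\xi\rangle\otimes|\eta\rangle)_{ij}=\xi_i\eta_j$. Put $|\psi_1\rangle=(z^1,-\bar z^2,z^3,-\bar z^4)^t$, $|\psi_2\rangle=(z^2,\bar z^1,z^4,\bar z^3)^t$ and, for $k=1,\dots,n+1$, $|\phi_k\rangle=a_k^{-1}|\psi_1\rangle^{\otimes(n-k+1)}\otimes_S|\psi_2\rangle^{\otimes(k-1)}$ with $a_k^2=\binom n{k-1}$, $a_k>0$, $\otimes_S$ denoting the sum over all distinct orderings of the factors. Then $\langle\phi_k|\phi_l\rangle=\delta_{kl}$ and $p_{(n)}=\sum_k|\phi_k\rangle\langle\phi_k|$ is a projection. The Grassmannian connection $\nabla=p_{(n)}\circ\mathrm{d}$ acts on coequivariant maps $\phi:V^{(n)}\to\mathcal{A}(S^7_{\theta'})$ by $\nabla(\phi)(e_k)=\mathrm{d}(\phi(e_k))+\sum_lA^{(n)}_{kl}\phi(e_l)$, with $A^{(n)}_{kl}=\langle\phi_k|\mathrm{d}\phi_l\rangle$. $\mathcal{A}(SU(2))$ is the commutative unital complex $*$-algebra generated by $w^1,\bar w^1,w^2,\bar w^2$ with $w^1\bar w^1+w^2\bar w^2=1$, counit $\epsilon(w^1)=\epsilon(\bar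 w^1)=1$, $\epsilon(w^2)=\epsilon(\bar w^2)=0$. The matrix coefficients $e^{(n)}_{kl}$ are taken in the orthonormal basis $e_k=a_k^{-1}\epsilon_1^{\otimes(n-k+1)}\otimes_S\epsilon_2^{\otimes(k-1)}$ of $\mathrm{Sym}^n(\mathbb{C}^2)$ ($\epsilon_1,\epsilon_2$ the canonical basis of $\mathbb{C}^2$): $\rho_n(w)e_l=\sum_ke^{(n)}_{kl}(w)e_k$ with $w=\begin{pmatrix}w^1&w^2\\-\bar w^2&\bar w^1\end{pmatrix}$ acting by $w^{\otimes n}$; in particular $(e^{(1)}_{kl})$ is this matrix. The map $\ell$. A vector space basis of $\mathcal{A}(SU(2))$ is $\{r^{kmn}:k\in\mathbb{Z},\,m,n\ge0\}$ with $r^{kmn}=(-1)^n(w^1)^k(w^2)^m(\bar w^2)^n$ for $k\ge0$ and $r^{kmn}=(-1)^n(w^2)^m(\bar w^2)^n(\bar w^1)^{-k}$ for $k<0$ (here $m,n$ are just exponents). The linear map $\ell$ is determined by $\ell(1)=1\otimes1$ and $$\ell(r^{k+1,m,n})=\bar z^1\ell(r^{kmn})z^1+z^2\ell(r^{kmn})\bar z^2+\bar z^3\ell(r^{kmn})z^3+z^4\ell(r^{kmn})\bar z^4\quad(k\ge0),$$ $$\ell(r^{k-1,m,n})=\bar z^2\ell(r^{kmn})z^2+z^1\ell(r^{kmn})\bar z^1+\bar z^4\ell(r^{kmn})z^4+z^3\ell(r^{kmn})\bar z^3\quad(k\le0),$$ $$\ell(r^{k,m+1,n})=\bar z^1\ell(r^{kmn})z^2-z^2\ell(r^{kmn})\bar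 z^1+\bar z^3\ell(r^{kmn})z^4-z^4\ell(r^{kmn})\bar z^3,$$ $$\ell(r^{k,m,n+1})=\bar z^2\ell(r^{kmn})z^1-z^1\ell(r^{kmn})\bar z^2+\bar z^4\ell(r^{kmn})z^3-z^3\ell(r^{kmn})\bar z^4,$$ where $a(p'\otimes p)b=ap'\otimes pb$. *)

(* Defs.v *)
From HB Require Import structures.
From mathcomp Require Import all_boot all_order all_algebra.
From mathcomp Require Import boolp reals trigo.
From mathcomp Require Import perm complex.

Set Implicit Arguments.
Unset Strict Implicit.
Unset Printing Implicit Defensive.

Import Order.TTheory GRing.Theory Num.Theory.
Local Open Scope ring_scope.
Local Open Scope quotient_scope.

(** * Unital algebras presented by generators and relations *)

Section Presentation.
Variables (C : comPzRingType) (G : Type).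

Inductive term : Type :=
| tgen of G
| tcst of C
| tadd of term & term
| tmul of term & term.

Definition tscale (c : C) (t : term) : term := tmul (tcst c) t.

HB.instance Definition _ := gen_eqMixin term.
HB.instance Definition _ := gen_choiceMixin term.

Variable rel : term -> term -> Prop.

(* The smallest congruence containing [rel] whose quotient is a unital
   associative C-algebra. *)
Inductive cong : term -> term -> Prop :=
| cong_rel s t : rel s t -> cong s t
| cong_refl t : cong t t
| cong_sym s t : cong s t -> cong t s
| cong_trans s t u : cong s t -> cong t u -> cong s u
| cong_add s s' t t' : cong s s' -> cong t t' -> cong (tadd s t) (tadd s' t')
| cong_mul s s' t t' : cong s s' -> cong t t' -> cong (tmul s t) (tmul s' t')
| cong_addA s t u : cong (tadd s (tadd t u)) (tadd (tadd s t) u)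
| cong_addC s t : cong (tadd s t) (tadd t s)
| cong_add0 t : cong (tadd (tcst 0) t) t
| cong_addN t : cong (tadd (tscale (-1) t) t) (tcst 0)
| cong_mulA s t u : cong (tmul s (tmul t u)) (tmul (tmul s t) u)
| cong_mul1l t : cong (tmul (tcst 1) t) t
| cong_mul1r t : cong (tmul t (tcst 1)) t
| cong_mulDl s t u : cong (tmul (tadd s t) u) (tadd (tmul s u) (tmul t u))
| cong_mulDr s t u : cong (tmul s (tadd t u)) (tadd (tmul s t) (tmul s u))
| cong_cstD c d : cong (tcst (c + d)) (tadd (tcst c) (tcst d))
| cong_cstM c d : cong (tcst (c * d)) (tmul (tcst c) (tcst d))
| cong_cstC c t : cong (tmul (tcst c) t) (tmul t (tcst c)).

Definition congb (s t : term) : bool := `[< cong s t >].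

Fact congb_refl : reflexive congb.
Proof. by move=> t; apply/asboolP/cong_refl. Qed.
Fact congb_sym : symmetric congb.
Proof. by move=> s t; apply/asboolP/asboolP; apply: cong_sym. Qed.
Fact congb_trans : transitive congb.
Proof.
by move=> t s u /asboolP st /asboolP tu; apply/asboolP/(cong_trans st tu).
Qed.

Canonical congb_equiv := EquivRel congb congb_refl congb_sym congb_trans.

Definition palg : Type := {eq_quot congb_equiv}.

HB.instance Definition _ := Choice.on palg.
HB.instance Definition _ := Quotient.on palg.

Definition pclass (t : term) : palg := \pi_palg t.

Lemma pclassP s t : cong s t <-> pclass s = pclass t.
Proof.
split=> [st|/eqmodP/asboolP //]; by apply/eqmodP/asboolP.
Qed.

Lemma pclass_repr (x : palg) : pclass (repr x) = x.
Proof. by rewrite /pclass reprK. Qed.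

Lemma repr_pclass t : cong (repr (pclass t)) t.
Proof. by apply/pclassP; rewrite pclass_repr. Qed.

Lemma palgW (P : palg -> Prop) : (forall t, P (pclass t)) -> forall x, P x.
Proof. by move=> Pt x; rewrite -(pclass_repr x). Qed.

Definition padd (x y : palg) : palg := pclass (tadd (repr x) (repr y)).
Definition pmul (x y : palg) : palg := pclass (tmul (repr x) (repr y)).
Definition pcst (c : C) : palg := pclass (tcst c).
Definition popp (x : palg) : palg := pclass (tscale (-1) (repr x)).

Fact pclassD_ s t : pclass (tadd s t) = padd (pclass s) (pclass t).
Proof. by apply/pclassP/cong_add; apply/cong_sym/repr_pclass. Qed.
Fact pclassM_ s t : pclass (tmul s t) = pmul (pclass s) (pclass t).
Proof. by apply/pclassP/cong_mul; apply/cong_sym/repr_pclass. Qed.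
Fact popp_ x : popp x = pmul (pcst (-1)) x.
Proof. by rewrite -[in RHS](pclass_repr x) -pclassM_. Qed.

Fact paddA : associative padd.
Proof.
elim/palgW=> s; elim/palgW=> t; elim/palgW=> u; rewrite -!pclassD_.
exact/pclassP/cong_addA.
Qed.
Fact paddC : commutative padd.
Proof.
elim/palgW=> s; elim/palgW=> t; rewrite -!pclassD_; exact/pclassP/cong_addC.
Qed.
Fact padd0 : left_id (pcst 0) padd.
Proof. elim/palgW=> s; rewrite -!pclassD_; exact/pclassP/cong_add0. Qed.
Fact paddN : left_inverse (pcst 0) popp padd.
Proof.
elim/palgW=> s; rewrite popp_ -pclassM_ -pclassD_; exact/pclassP/cong_addN.
Qed.
Fact pmulA : associative pmul.
Proof.
elim/palgW=> s; elim/palgW=> t; elim/palgW=> u; rewrite -!pclassM_.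
exact/pclassP/cong_mulA.
Qed.
Fact pmul1l : left_id (pcst 1) pmul.
Proof. elim/palgW=> s; rewrite -!pclassM_; exact/pclassP/cong_mul1l. Qed.
Fact pmul1r : right_id (pcst 1) pmul.
Proof. elim/palgW=> s; rewrite -!pclassM_; exact/pclassP/cong_mul1r. Qed.
Fact pmulDl : left_distributive pmul padd.
Proof.
elim/palgW=> s; elim/palgW=> t; elim/palgW=> u.
rewrite -!(pclassD_, pclassM_); exact/pclassP/cong_mulDl.
Qed.
Fact pmulDr : right_distributive pmul padd.
Proof.
elim/palgW=> s; elim/palgW=> t; elim/palgW=> u.
rewrite -!(pclassD_, pclassM_); exact/pclassP/cong_mulDr.
Qed.

HB.instance Definition _ := GRing.isZmodule.Build palg paddA paddC padd0 paddN.
HB.instance Definition _ :=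
  GRing.Zmodule_isPzRing.Build palg pmulA pmul1l pmul1r pmulDl pmulDr.

Lemma pclassD s t : pclass (tadd s t) = pclass s + pclass t.
Proof. exact: pclassD_. Qed.
Lemma pclassM s t : pclass (tmul s t) = pclass s * pclass t.
Proof. exact: pclassM_. Qed.
Lemma pcst0 : pcst 0 = 0. Proof. by []. Qed.
Lemma pcst1 : pcst 1 = 1. Proof. by []. Qed.
Lemma pcstD c d : pcst (c + d) = pcst c + pcst d.
Proof. by rewrite /pcst -pclassD; apply/pclassP/cong_cstD. Qed.
Lemma pcstM c d : pcst (c * d) = pcst c * pcst d.
Proof. by rewrite /pcst -pclassM; apply/pclassP/cong_cstM. Qed.
Lemma pcstC c x : pcst c * x = x * pcst c.
Proof. by elim/palgW: x => t; rewrite -!pclassM; apply/pclassP/cong_cstC. Qed.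

Definition pscale (c : C) (x : palg) : palg := pcst c * x.

Fact pscaleA a b x : pscale a (pscale b x) = pscale (a * b) x.
Proof. by rewrite /pscale mulrA pcstM. Qed.
Fact pscale1 : left_id 1 pscale.
Proof. by move=> x; rewrite /pscale pcst1 mul1r. Qed.
Fact pscaleDr : right_distributive pscale +%R.
Proof. by move=> c x y; rewrite /pscale mulrDr. Qed.
Fact pscaleDl x : {morph pscale^~ x : a b / a + b}.
Proof. by move=> a b; rewrite /pscale pcstD mulrDl. Qed.

HB.instance Definition _ := GRing.Zmodule_isLmodule.Build C palg
  pscaleA pscale1 pscaleDr pscaleDl.

Lemma pscaleE c (x : palg) : c *: x = pcst c * x. Proof. by []. Qed.
Lemma pcstE c : pcst c = c *: (1 : palg). Proof. by rewrite pscaleE mulr1. Qed.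
Lemma pscaleAl c (x y : palg) : c *: (x * y) = (c *: x) * y.
Proof. by rewrite !pscaleE mulrA. Qed.
Lemma pscaleAr c (x y : palg) : c *: (x * y) = x * (c *: y).
Proof. by rewrite !pscaleE !mulrA pcstC. Qed.
Lemma pclassZ c t : pclass (tscale c t) = c *: pclass t.
Proof. by rewrite pclassM. Qed.

Lemma pclass_sum I (r : seq I) (F : I -> term) :
  pclass (\big[tadd/tcst 0]_(i <- r) F i) = \sum_(i <- r) pclass (F i).
Proof. exact: (big_morph pclass pclassD). Qed.

(* Evaluation of terms in an algebra whose scalars are given by [k]. *)
Section Eval.
Variables (B : pzRingType) (k : {rmorphism C -> B}) (f : G -> B).

Fixpoint teval (t : term) : B :=
  match t with
  | tgen g => f g
  | tcst c => k c
  | tadd s t => teval s + teval t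
  | tmul s t => teval s * teval t
  end.

Lemma teval_sum I (r : seq I) (F : I -> term) :
  teval (\big[tadd/tcst 0]_(i <- r) F i) = \sum_(i <- r) teval (F i).
Proof.
elim: r => [|i r IHr]; first by rewrite !big_nil /= rmorph0.
by rewrite !big_cons /= IHr.
Qed.

Hypothesis kC : forall c x, k c * x = x * k c.
Hypothesis frel : forall s t, rel s t -> teval s = teval t.

Lemma teval_cong s t : cong s t -> teval s = teval t.
Proof.
elim=> //= *.
- by congruence.
- by congruence.
- by congruence.
- by rewrite addrA.
- by rewrite addrC.
- by rewrite rmorph0 add0r.
- by rewrite rmorphN1 mulN1r addNr rmorph0.
- by rewrite mulrA.
- by rewrite rmorph1 mul1r.
- by rewrite rmorph1 mulr1.
- by rewrite mulrDl.
- by rewrite mulrDr.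
- by rewrite rmorphD.
- by rewrite rmorphM.
Qed.

Definition plift (x : palg) : B := teval (repr x).

Lemma plift_class t : plift (pclass t) = teval t.
Proof. exact/teval_cong/repr_pclass. Qed.
Lemma pliftD x y : plift (x + y) = plift x + plift y.
Proof. by elim/palgW: x => s; elim/palgW: y => t; rewrite -pclassD !plift_class. Qed.
Lemma pliftM x y : plift (x * y) = plift x * plift y.
Proof. by elim/palgW: x => s; elim/palgW: y => t; rewrite -pclassM !plift_class. Qed.
Lemma plift_cst c : plift (pcst c) = k c.
Proof. by rewrite plift_class. Qed.

End Eval.

End Presentation.

Arguments tcst {C G} c.
Arguments tgen {C G} g.
Arguments tadd {C G} s t : rename.
Arguments tmul {C G} s t : rename.

Declare Scope term_scope.
Delimit Scope term_scope with T.
Notation "s + t" := (tadd s t) : term_scope.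
Notation "s * t" := (tmul s t) : term_scope.
Notation "c *: t" := (tscale c t) : term_scope.
Notation "0" := (tcst 0) : term_scope.
Notation "1" := (tcst 1) : term_scope.
Bind Scope term_scope with term.

Notation "\sum_ ( i < n ) F" := (\big[tadd/(tcst 0)]_(i < n) F%T) : term_scope.

(** * The algebraic tensor product of two C-modules *)

Section Tensor.
Variables (C : comPzRingType) (V W : lmodType C).

Inductive tterm : Type :=
| tt0
| ttpure of V & W
| ttadd of tterm & tterm
| ttscale of C & tterm.

HB.instance Definition _ := gen_eqMixin tterm.
HB.instance Definition _ := gen_choiceMixin tterm.

Inductive tcong : tterm -> tterm -> Prop :=
| tcong_refl t : tcong t t
| tcong_sym s t : tcong s t -> tcong t s
| tcong_trans s t u : tcong s t -> tcong t u -> tcong s u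
| tcong_add s s' t t' :
    tcong s s' -> tcong t t' -> tcong (ttadd s t) (ttadd s' t')
| tcong_scale c s s' : tcong s s' -> tcong (ttscale c s) (ttscale c s')
| tcong_addA s t u : tcong (ttadd s (ttadd t u)) (ttadd (ttadd s t) u)
| tcong_addC s t : tcong (ttadd s t) (ttadd t s)
| tcong_add0 t : tcong (ttadd tt0 t) t
| tcong_addN t : tcong (ttadd (ttscale (-1) t) t) tt0
| tcong_scaleA c d t : tcong (ttscale c (ttscale d t)) (ttscale (c * d) t)
| tcong_scale1 t : tcong (ttscale 1 t) t
| tcong_scaleDr c s t :
    tcong (ttscale c (ttadd s t)) (ttadd (ttscale c s) (ttscale c t))
| tcong_scaleDl c d t :
    tcong (ttscale (c + d) t) (ttadd (ttscale c t) (ttscale d t))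
| tcong_pureDl v v' w :
    tcong (ttpure (v + v') w) (ttadd (ttpure v w) (ttpure v' w))
| tcong_pureDr v w w' :
    tcong (ttpure v (w + w')) (ttadd (ttpure v w) (ttpure v w'))
| tcong_pureZl c v w : tcong (ttpure (c *: v) w) (ttscale c (ttpure v w))
| tcong_pureZr c v w : tcong (ttpure v (c *: w)) (ttscale c (ttpure v w)).

Definition tcongb (s t : tterm) : bool := `[< tcong s t >].

Fact tcongb_refl : reflexive tcongb.
Proof. by move=> t; apply/asboolP/tcong_refl. Qed.
Fact tcongb_sym : symmetric tcongb.
Proof. by move=> s t; apply/asboolP/asboolP; apply: tcong_sym. Qed.
Fact tcongb_trans : transitive tcongb.
Proof.
by move=> t s u /asboolP st /asboolP tu; apply/asboolP/(tcong_trans st tu).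
Qed.

Canonical tcongb_equiv := EquivRel tcongb tcongb_refl tcongb_sym tcongb_trans.

Definition tensor : Type := {eq_quot tcongb_equiv}.

HB.instance Definition _ := Choice.on tensor.
HB.instance Definition _ := Quotient.on tensor.

Definition tclass (t : tterm) : tensor := \pi_tensor t.

Lemma tclassP s t : tcong s t <-> tclass s = tclass t.
Proof. split=> [st|/eqmodP/asboolP //]; by apply/eqmodP/asboolP. Qed.

Lemma tclass_repr (x : tensor) : tclass (repr x) = x.
Proof. by rewrite /tclass reprK. Qed.

Lemma repr_tclass t : tcong (repr (tclass t)) t.
Proof. by apply/tclassP; rewrite tclass_repr. Qed.

Lemma tensorW (P : tensor -> Prop) : (forall t, P (tclass t)) -> forall x, P x.
Proof. by move=> Pt x; rewrite -(tclass_repr x). Qed.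

Definition tnadd (x y : tensor) : tensor := tclass (ttadd (repr x) (repr y)).
Definition tnscale c (x : tensor) : tensor := tclass (ttscale c (repr x)).
Definition tnopp (x : tensor) : tensor := tnscale (-1) x.

Fact tclassD_ s t : tclass (ttadd s t) = tnadd (tclass s) (tclass t).
Proof. by apply/tclassP/tcong_add; apply/tcong_sym/repr_tclass. Qed.
Fact tclassZ_ c t : tclass (ttscale c t) = tnscale c (tclass t).
Proof. by apply/tclassP/tcong_scale/tcong_sym/repr_tclass. Qed.

Fact tnaddA : associative tnadd.
Proof.
elim/tensorW=> s; elim/tensorW=> t; elim/tensorW=> u; rewrite -!tclassD_.
exact/tclassP/tcong_addA.
Qed.
Fact tnaddC : commutative tnadd.
Proof.
elim/tensorW=> s; elim/tensorW=> t; rewrite -!tclassD_; exact/tclassP/tcong_addC.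
Qed.
Fact tnadd0 : left_id (tclass tt0) tnadd.
Proof. elim/tensorW=> s; rewrite -!tclassD_; exact/tclassP/tcong_add0. Qed.
Fact tnaddN : left_inverse (tclass tt0) tnopp tnadd.
Proof.
elim/tensorW=> s; rewrite /tnopp -tclassZ_ -tclassD_.
exact/tclassP/tcong_addN.
Qed.

HB.instance Definition _ :=
  GRing.isZmodule.Build tensor tnaddA tnaddC tnadd0 tnaddN.

Fact tnscaleA a b x : tnscale a (tnscale b x) = tnscale (a * b) x.
Proof. elim/tensorW: x => t; rewrite -!tclassZ_; exact/tclassP/tcong_scaleA. Qed.
Fact tnscale1 : left_id 1 tnscale.
Proof. elim/tensorW=> t; rewrite -!tclassZ_; exact/tclassP/tcong_scale1. Qed.
Fact tnscaleDr : right_distributive tnscale tnadd.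
Proof.
move=> c; elim/tensorW=> s; elim/tensorW=> t.
rewrite -!(tclassZ_, tclassD_); exact/tclassP/tcong_scaleDr.
Qed.
Fact tnscaleDl x :
  {morph tnscale^~ x : a b / a + b >-> tnadd a b}.
Proof.
elim/tensorW: x => t a b.
rewrite -!(tclassZ_, tclassD_); exact/tclassP/tcong_scaleDl.
Qed.

HB.instance Definition _ := GRing.Zmodule_isLmodule.Build C tensor
  tnscaleA tnscale1 tnscaleDr tnscaleDl.

Definition pure (v : V) (w : W) : tensor := tclass (ttpure v w).

Lemma tclass0 : tclass tt0 = 0. Proof. by []. Qed.
Lemma tclassD s t : tclass (ttadd s t) = tclass s + tclass t.
Proof. exact: tclassD_. Qed.
Lemma tclassZ c t : tclass (ttscale c t) = c *: tclass t.
Proof. exact: tclassZ_. Qed.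
Lemma pureDl v v' w : pure (v + v') w = pure v w + pure v' w.
Proof. by rewrite /pure -tclassD; apply/tclassP/tcong_pureDl. Qed.
Lemma pureDr v w w' : pure v (w + w') = pure v w + pure v w'.
Proof. by rewrite /pure -tclassD; apply/tclassP/tcong_pureDr. Qed.
Lemma pureZl c v w : pure (c *: v) w = c *: pure v w.
Proof. by rewrite /pure -tclassZ; apply/tclassP/tcong_pureZl. Qed.
Lemma pureZr c v w : pure v (c *: w) = c *: pure v w.
Proof. by rewrite /pure -tclassZ; apply/tclassP/tcong_pureZr. Qed.

Lemma tensor_ind (P : tensor -> Prop) :
    P 0 -> (forall v w, P (pure v w)) ->
    (forall x y, P x -> P y -> P (x + y)) ->
    (forall c x, P x -> P (c *: x)) ->
  forall x, P x.
Proof.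
move=> P0 Pp PD PZ; elim/tensorW; elim=> //= [s Ps t Pt|c t Pt].
  by rewrite tclassD; apply: PD.
by rewrite tclassZ; apply: PZ.
Qed.

Section Lift.
Variables (U : lmodType C) (f : V -> W -> U).
Hypothesis fl : forall w, linear (f^~ w).
Hypothesis fr : forall v, linear (f v).

Fixpoint tteval (t : tterm) : U :=
  match t with
  | tt0 => 0
  | ttpure v w => f v w
  | ttadd s t => tteval s + tteval t
  | ttscale c t => c *: tteval t
  end.

Lemma tteval_cong s t : tcong s t -> tteval s = tteval t.
Proof.
have fl' w c v v' : f (c *: v + v') w = c *: f v w + f v' w by exact: fl.
have fr' v c w w' : f v (c *: w + w') = c *: f v w + f v w' by exact: fr.
have f0l w : f 0 w = 0.
  by move: (fl' w 1 0 0); rewrite !scale1r addr0 -[LHS]addr0 => /addrI <-.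
have f0r v : f v 0 = 0.
  by move: (fr' v 1 0 0); rewrite !scale1r addr0 -[LHS]addr0 => /addrI <-.
elim=> //= *.
- by congruence.
- by congruence.
- by congruence.
- by rewrite addrA.
- by rewrite addrC.
- by rewrite add0r.
- by rewrite scaleN1r addNr.
- by rewrite scalerA.
- by rewrite scale1r.
- by rewrite scalerDr.
- by rewrite scalerDl.
- by rewrite -[X in f (X + _)]scale1r fl' scale1r.
- by rewrite -[X in f _ (X + _)]scale1r fr' scale1r.
- by rewrite -[X in f X _]addr0 fl' f0l addr0.
- by rewrite -[X in f _ X]addr0 fr' f0r addr0.
Qed.

Definition tlift (x : tensor) : U := tteval (repr x).

Lemma tlift_class t : tlift (tclass t) = tteval t.
Proof. exact/tteval_cong/repr_tclass. Qed.
Lemma tlift_pure v w : tlift (pure v w) = f v w.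
Proof. exact: tlift_class. Qed.
Fact tlift_linear : linear tlift.
Proof.
move=> c; elim/tensorW=> s; elim/tensorW=> t.
by rewrite -tclassZ -tclassD !tlift_class.
Qed.

End Lift.

End Tensor.

(* The scalars of a presented algebra, as ring morphisms. *)
HB.instance Definition _ (C : comPzRingType) (G : Type) rel :=
  GRing.isNmodMorphism.Build C (palg rel) (@pcst C G rel)
    (pcst0 rel, @pcstD C G rel).
HB.instance Definition _ (C : comPzRingType) (G : Type) rel :=
  GRing.isMonoidMorphism.Build C (palg rel) (@pcst C G rel)
    (pcst1 rel, @pcstM C G rel).

(** * The algebra of the sphere S^7_theta' *)

Section Sphere.
Variables (R : realType) (theta : R).
Local Notation C := R[i].

Definition mu : C := (cos (pi * theta) +i* sin (pi * theta))%C.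

(* The indices 1, 2, 3, 4 are the elements 0, 1, 2, 3 of 'I_4. *)
Definition i1 : 'I_4 := @Ordinal 4 0 isT.
Definition i2 : 'I_4 := @Ordinal 4 1 isT.
Definition i3 : 'I_4 := @Ordinal 4 2 isT.
Definition i4 : 'I_4 := @Ordinal 4 3 isT.

Definition lambda' (i j : 'I_4) : C :=
  if (i < 2)%N == (j < 2)%N then 1 else if (i < 2)%N then mu else mu^*.

Inductive s7gen : Type := gz of 'I_4 | gzb of 'I_4.

Definition s7bar (g : s7gen) : s7gen :=
  match g with gz i => gzb i | gzb i => gz i end.

Local Notation tz i := (tgen (gz i)).
Local Notation tzb i := (tgen (gzb i)).

Inductive s7rel : term C s7gen -> term C s7gen -> Prop :=
| s7_zz i j : s7rel (tz i * tz j)%T (lambda' i j *: (tz j * tz i))%T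
| s7_zbz i j : s7rel (tzb i * tz j)%T (lambda' j i *: (tz j * tzb i))%T
| s7_zbzb i j : s7rel (tzb i * tzb j)%T (lambda' i j *: (tzb j * tzb i))%T
| s7_sphere : s7rel (\sum_(i < 4) tz i * tzb i)%T 1%T.

Definition S7 : Type := palg s7rel.

HB.instance Definition _ := GRing.PzRing.on S7.
HB.instance Definition _ := GRing.Lmodule.on S7.

Definition z (i : 'I_4) : S7 := pclass s7rel (tz i).
Definition zb (i : 'I_4) : S7 := pclass s7rel (tzb i).

Lemma conj_lambda' i j : (lambda' i j)^* = lambda' j i.
Proof.
rewrite /lambda' eq_sym; case: eqP => [|ij]; first by rewrite rmorph1.
by case: ifP ij; case: ifP => // *; rewrite conjCK.
Qed.

Lemma mu_conj : mu * mu^* = 1.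
Proof.
rewrite /mu /=; apply/eqP; rewrite eq_complex /= mulrN opprK -!expr2 cos2Dsin2.
by rewrite mulrN mulrC addNr !eqxx.
Qed.

Lemma lambda'_inv i j : lambda' i j * lambda' j i = 1.
Proof.
rewrite /lambda' eq_sym; case: eqP => [|ij]; first by rewrite mulr1.
by case: ifP ij; case: ifP => // *; first [rewrite mu_conj | rewrite mulrC mu_conj].
Qed.

Lemma zzE i j : z i * z j = lambda' i j *: (z j * z i).
Proof.
by rewrite /z -!pclassM -pclassZ; apply/pclassP/cong_rel/s7_zz.
Qed.
Lemma zbzE i j : zb i * z j = lambda' j i *: (z j * zb i).
Proof.
by rewrite /z /zb -!pclassM -pclassZ; apply/pclassP/cong_rel/s7_zbz.
Qed.
Lemma zbzbE i j : zb i * zb j = lambda' i j *: (zb j * zb i).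
Proof.
by rewrite /zb -!pclassM -pclassZ; apply/pclassP/cong_rel/s7_zbzb.
Qed.
Lemma zzbE i j : z i * zb j = lambda' j i *: (zb j * z i).
Proof. by rewrite zbzE scalerA lambda'_inv scale1r. Qed.
Lemma sum_zzb : \sum_i z i * zb i = 1.
Proof.
have /pclassP : cong s7rel (\sum_(i < 4) tz i * tzb i)%T 1%T.
  exact/cong_rel/s7_sphere.
rewrite pclass_sum => E.
by rewrite -[RHS]E; apply: eq_bigr => i _; rewrite pclassM.
Qed.

(* The involution, as an algebra morphism to the opposite ring. *)
Definition conj_cst (c : C) : S7^c := pcst s7rel c^*.

Fact conj_cst_nmod : nmod_morphism conj_cst.
Proof.
split=> [|c d]; rewrite /conj_cst ?rmorph0 // rmorphD; exact: pcstD.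
Qed.
Fact conj_cst_monoid : monoid_morphism conj_cst.
Proof.
split=> [|c d]; rewrite /conj_cst ?rmorph1 // rmorphM mulrC; exact: pcstM.
Qed.
HB.instance Definition _ :=
  GRing.isNmodMorphism.Build C S7^c conj_cst conj_cst_nmod.
HB.instance Definition _ :=
  GRing.isMonoidMorphism.Build C S7^c conj_cst conj_cst_monoid.

Definition star (x : S7) : S7 :=
  plift conj_cst (fun g => pclass s7rel (tgen (s7bar g)) : S7^c) x.

Fact star_rel s t : s7rel s t ->
  teval conj_cst (fun g => pclass s7rel (tgen (s7bar g)) : S7^c) s =
  teval conj_cst (fun g => pclass s7rel (tgen (s7bar g)) : S7^c) t.
Proof.
have cstE c (x : S7) : (x : S7^c) * conj_cst c = c^* *: x.
  by rewrite pscaleE.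
have cstE' c (x : S7) : conj_cst c * (x : S7^c) = c^* *: x.
  by rewrite pscaleE pcstC.
case=> [i j|i j|i j|]; rewrite /tscale /= ?cstE' ?conj_lambda'.
- exact: zbzbE.
- exact: zbzE.
- exact: zzE.
- rewrite teval_sum /=.
  rewrite rmorph1 -[RHS]sum_zzb; exact: eq_bigr.
Qed.

Fact conj_cstC c (x : S7^c) : conj_cst c * x = x * conj_cst c.
Proof. exact/esym/pcstC. Qed.

Lemma star_class t :
  star (pclass s7rel t) =
  teval conj_cst (fun g => pclass s7rel (tgen (s7bar g)) : S7^c) t.
Proof. exact: (plift_class conj_cstC star_rel). Qed.
Lemma star_z i : star (z i) = zb i. Proof. exact: star_class. Qed.
Lemma star_zb i : star (zb i) = z i. Proof. exact: star_class. Qed.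
Lemma starD x y : star (x + y) = star x + star y.
Proof. exact: (pliftD conj_cstC star_rel). Qed.
Lemma starM x y : star (x * y) = star y * star x.
Proof. exact: (pliftM conj_cstC star_rel). Qed.
Lemma starZ c x : star (c *: x) = c^* *: star x.
Proof.
rewrite {1}pscaleE starM pscaleE pcstC; congr (_ * _).
exact: (plift_cst conj_cstC star_rel).
Qed.

(** * The differential calculus *)

(* [gf g] is the generator [g] in degree 0 and [gd g] its differential. *)
Inductive omgen : Type := gf of s7gen | gd of s7gen.

Local Notation fz i := (tgen (gf (gz i))).
Local Notation fzb i := (tgen (gf (gzb i))).
Local Notation dz i := (tgen (gd (gz i))).
Local Notation dzb i := (tgen (gd (gzb i))).

(* The adjoints of the relations among the dz and dzb, and of those of S7, are
   again relations of the same family. *)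
Inductive omrel : term C omgen -> term C omgen -> Prop :=
| om_zz i j : omrel (fz i * fz j)%T (lambda' i j *: (fz j * fz i))%T
| om_zbz i j : omrel (fzb i * fz j)%T (lambda' j i *: (fz j * fzb i))%T
| om_zbzb i j : omrel (fzb i * fzb j)%T (lambda' i j *: (fzb j * fzb i))%T
| om_sphere : omrel (\sum_(i < 4) fz i * fzb i)%T 1%T
| om_zdz i j : omrel (fz i * dz j)%T (lambda' i j *: (dz j * fz i))%T
| om_zbdz i j : omrel (fzb i * dz j)%T (lambda' j i *: (dz j * fzb i))%T
| om_zbdzb i j : omrel (fzb i * dzb j)%T (lambda' i j *: (dzb j * fzb i))%T
| om_zdz_adj i j :
    omrel (dzb j * fzb i)%T ((lambda' i j)^* *: (fzb i * dzb j))%T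
| om_zbdz_adj i j :
    omrel (dzb j * fz i)%T ((lambda' j i)^* *: (fz i * dzb j))%T
| om_zbdzb_adj i j :
    omrel (dz j * fz i)%T ((lambda' i j)^* *: (fz i * dz j))%T
| om_dzdz i j : omrel (dz i * dz j + lambda' i j *: (dz j * dz i))%T 0%T
| om_dzbdz i j : omrel (dzb i * dz j + lambda' j i *: (dz j * dzb i))%T 0%T
| om_dzbdzb i j : omrel (dzb i * dzb j + lambda' i j *: (dzb j * dzb i))%T 0%T
| om_dsphere : omrel (\sum_(i < 4) (dz i * fzb i + fz i * dzb i))%T 0%T.

Definition Om : Type := palg omrel.

HB.instance Definition _ := GRing.PzRing.on Om.
HB.instance Definition _ := GRing.Lmodule.on Om.

Local Notation omc := (pclass omrel).

Fact omE s t : omrel s t -> omc s = omc t.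
Proof. by move=> st; apply/pclassP/cong_rel. Qed.

(* The inclusion of degree 0. *)
Definition om0 (x : S7) : Om :=
  plift (pcst omrel) (fun g => omc (tgen (gf g))) x.

Fact iota_rel s t : s7rel s t ->
  teval (pcst omrel) (fun g => omc (tgen (gf g))) s =
  teval (pcst omrel) (fun g => omc (tgen (gf g))) t.
Proof.
case=> [i j|i j|i j|]; rewrite /tscale /=.
- by move: (omE (om_zz i j)); rewrite pclassZ !pclassM.
- by move: (omE (om_zbz i j)); rewrite pclassZ !pclassM.
- by move: (omE (om_zbzb i j)); rewrite pclassZ !pclassM.
- rewrite teval_sum -[RHS](omE om_sphere) pclass_sum.
  by apply: eq_bigr => i _; rewrite pclassM.
Qed.

Lemma iota_class t :
  om0 (pclass s7rel t) = teval (pcst omrel) (fun g => omc (tgen (gf g))) t.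
Proof. exact: (plift_class (pcstC (rel := omrel)) iota_rel). Qed.
Lemma iotaD x y : om0 (x + y) = om0 x + om0 y.
Proof. exact: (pliftD (pcstC (rel := omrel)) iota_rel). Qed.
Lemma iotaM x y : om0 (x * y) = om0 x * om0 y.
Proof. exact: (pliftM (pcstC (rel := omrel)) iota_rel). Qed.
Lemma iota_cst c : om0 (pcst s7rel c) = pcst omrel c.
Proof. exact: (plift_cst (pcstC (rel := omrel)) iota_rel). Qed.
Lemma iotaZ c x : om0 (c *: x) = c *: om0 x.
Proof. by rewrite !pscaleE iotaM iota_cst. Qed.

(* The grading automorphism, multiplication by (-1)^p on forms of degree p. *)
Definition tgrad : term C omgen -> Om :=
  teval (pcst omrel)
    (fun g => match g with
              | gf _ => omc (tgen g)
              | gd _ => - omc (tgen g)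
              end).

Fact tgrad_rel s t : omrel s t -> tgrad s = tgrad t.
Proof.
rewrite /tgrad => st; have := omE st.
case: st => [i j|i j|i j||i j|i j|i j|i j|i j|i j|i j|i j|i j|];
  rewrite /tscale /= ?(pclassM, pclassD) ?(mulNr, mulrN, opprK) => E //.
all: try by congr (- _).
- by rewrite teval_sum -[RHS]E pclass_sum; apply: eq_bigr => i _; rewrite pclassM.
- rewrite teval_sum; transitivity (- omc 0%T); last exact: oppr0.
  rewrite -E pclass_sum -sumrN; apply: eq_bigr => i _ /=.
  by rewrite pclassD !pclassM mulNr mulrN opprD.
Qed.

Fact tgrad_cong s t : cong omrel s t -> tgrad s = tgrad t.
Proof. exact: (teval_cong (pcstC (rel := omrel)) tgrad_rel). Qed.

(* The derivation, for the grading above, with d (gf g) = gd g and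
   d (gd g) = 0. *)
Fixpoint tdiff (t : term C omgen) : Om :=
  match t with
  | tgen (gf g) => omc (tgen (gd g))
  | tgen (gd g) => 0
  | tcst c => 0
  | tadd s t => tdiff s + tdiff t
  | tmul s t => tdiff s * omc t + tgrad s * tdiff t
  end.

Definition dif (x : Om) : Om := tdiff (repr x).

Fact tdiff_sum I (r : seq I) (F : I -> term C omgen) :
  tdiff (\big[tadd/tcst 0]_(i <- r) F i) = \sum_(i <- r) tdiff (F i).
Proof. by elim/big_rec2: _ => //= i x y _ <-. Qed.

Fact om_sub0 (c : C) (x y : Om) : x + c *: y = 0 -> x = - (c *: y).
Proof. by move/eqP; rewrite addr_eq0 => /eqP. Qed.

Fact tdiff_rel s t : omrel s t -> tdiff s = tdiff t.
Proof.
have E3 s0 t0 c s1 t1 : omrel (s0 * t0)%T (c *: (s1 * t1))%T ->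
    omc s0 * omc t0 = c *: (omc s1 * omc t1).
  by move/omE; rewrite pclassZ !pclassM.
have E4 s0 t0 c s1 t1 : omrel (s0 * t0 + c *: (s1 * t1))%T 0%T ->
    omc s0 * omc t0 = - (c *: (omc s1 * omc t1)).
  by move/omE; rewrite pclassD pclassZ !pclassM => /om_sub0.
case=> [i j|i j|i j||i j|i j|i j|i j|i j|i j|i j|i j|i j|];
  rewrite /tscale /= ?(mul0r, mulr0, add0r, addr0) //.
- rewrite (E3 _ _ _ _ _ (om_zdz i j)) (E3 _ _ _ _ _ (om_zbdzb_adj j i)).
  by rewrite conj_lambda' addrC -scalerDr.
- rewrite (E3 _ _ _ _ _ (om_zbdz i j)) (E3 _ _ _ _ _ (om_zbdz_adj j i)).
  by rewrite conj_lambda' addrC -scalerDr.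
- rewrite (E3 _ _ _ _ _ (om_zbdzb i j)) (E3 _ _ _ _ _ (om_zdz_adj j i)).
  by rewrite conj_lambda' addrC -scalerDr.
- rewrite tdiff_sum -[RHS](omE om_dsphere) pclass_sum.
  by apply: eq_bigr => i _; rewrite pclassD !pclassM.
- by rewrite (E4 _ _ _ _ _ (om_dzdz i j)) mulNr mulrN.
- by rewrite (E4 _ _ _ _ _ (om_dzbdz i j)) mulNr mulrN.
- by rewrite (E4 _ _ _ _ _ (om_dzbdzb i j)) mulNr mulrN.
- by rewrite mulNr (E4 _ _ _ _ _ (om_dzbdzb j i)) opprK conj_lambda'.
- by rewrite mulNr (E4 _ _ _ _ _ (om_dzbdz j i)) opprK conj_lambda'.
- by rewrite mulNr (E4 _ _ _ _ _ (om_dzdz j i)) opprK conj_lambda'.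
- rewrite tdiff_sum big1 // => i _ /=.
  by rewrite mul0r mulr0 add0r addr0 mulNr addNr.
Qed.

Fact tdiff_cong s t : cong omrel s t -> tdiff s = tdiff t.
Proof.
move=> st; have : tdiff s = tdiff t /\ tgrad s = tgrad t; last by case.
split; last exact: tgrad_cong.
elim: st => //= {s t}.
- exact: tdiff_rel.
- by move=> *; congruence.
- by move=> *; congruence.
- by move=> s s' t t' /tgrad_cong gs ds /pclassP et dt; rewrite gs ds et dt.
- by move=> *; rewrite addrA.
- by move=> *; rewrite addrC.
- by move=> *; rewrite add0r.
- by move=> t; rewrite mul0r add0r -[X in _ + X]scale1r -scalerDl addNr scale0r.
- by move=> s t u; rewrite !pclassM mulrDl mulrDr !mulrA addrA.
- by move=> t; rewrite mul0r add0r [LHS]mul1r.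
- by move=> t; rewrite mulr0 addr0 [LHS]mulr1.
- by move=> s t u; rewrite !mulrDl addrACA.
- by move=> s t u; rewrite !pclassD !mulrDr addrACA.
- by move=> *; rewrite addr0.
- by move=> *; rewrite mul0r mulr0 addr0.
- by move=> c t; rewrite mul0r add0r mulr0 addr0 [LHS]pcstC.
Qed.

Lemma dif_class t : dif (pclass omrel t) = tdiff t.
Proof. exact/tdiff_cong/repr_pclass. Qed.
Lemma difD x y : dif (x + y) = dif x + dif y.
Proof.
by elim/palgW: x => s; elim/palgW: y => t; rewrite -pclassD !dif_class.
Qed.
Lemma difZ c x : dif (c *: x) = c *: dif x.
Proof.
by elim/palgW: x => t; rewrite -pclassZ !dif_class /= mul0r add0r.
Qed.

(* The graded Leibniz rule when the left factor has degree 0. *)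
Lemma dif_iotaM (x : S7) (y : Om) :
  dif (om0 x * y) = dif (om0 x) * y + om0 x * dif y.
Proof.
have [t -> tE] : exists2 t, om0 x = omc t & tgrad t = omc t.
  elim/palgW: x => s; rewrite iota_class.
  elim: s => [g|c|s [s' Is Es] u [u' Iu Eu]|s [s' Is Es] u [u' Iu Eu]] /=.
  - by exists (tgen (gf g)).
  - by exists (tcst c).
  - exists (s' + u')%T; first by rewrite Is Iu pclassD.
    by rewrite pclassD -Es -Eu.
  - exists (s' * u')%T; first by rewrite Is Iu pclassM.
    by rewrite pclassM -Es -Eu.
elim/palgW: y => u; rewrite -pclassM !dif_class /= tE.
by [].
Qed.

(** * The degree one part of the universal calculus and the map pi *)

Local Notation A2 := (tensor S7 S7).

Definition umul : A2 -> S7 := tlift (fun a b : S7 => a * b).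

(* a (p (x) q) b = ap (x) qb *)
Definition bimod (a b : S7) : A2 -> A2 :=
  tlift (fun p q : S7 => pure (a * p) (q * b)).

(* Omega^1_un is the kernel of the multiplication. *)
Definition Omega1un : {pred A2} := fun t => umul t == 0.

Definition delta (a : S7) : A2 := pure (1 : S7) a - pure a (1 : S7).

(* On Omega1un, the multiplicative map with a |-> a and delta a |-> d a is
   sum_i a_i (x) b_i |-> sum_i a_i d b_i, because sum_i a_i b_i = 0 gives
   sum_i a_i (x) b_i = sum_i a_i delta(b_i). *)
Definition pi1 : A2 -> Om := tlift (fun a b : S7 => om0 a * dif (om0 b)).

Fact umul_linl (b : S7) : linear (fun a : S7 => a * b).
Proof. by move=> c x y; rewrite mulrDl -[in LHS]pscaleAl. Qed.
Fact umul_linr (a : S7) : linear (fun b : S7 => a * b).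
Proof. by move=> c x y; rewrite mulrDr -[in LHS]pscaleAr. Qed.
Fact bimod_linl a b (q : S7) : linear (fun p : S7 => pure (a * p) (q * b)).
Proof. by move=> c x y; rewrite mulrDr -[in LHS]pscaleAr pureDl pureZl. Qed.
Fact bimod_linr a b (p : S7) : linear (fun q : S7 => pure (a * p) (q * b)).
Proof. by move=> c x y; rewrite mulrDl -[in LHS]pscaleAl pureDr pureZr. Qed.
Fact pi1_linl (b : S7) : linear (fun a : S7 => om0 a * dif (om0 b)).
Proof. by move=> c x y; rewrite iotaD iotaZ mulrDl -[in LHS]pscaleAl. Qed.
Fact pi1_linr (a : S7) : linear (fun b : S7 => om0 a * dif (om0 b)).
Proof.
by move=> c x y; rewrite iotaD iotaZ difD difZ mulrDr -[in LHS]pscaleAr.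
Qed.

HB.instance Definition _ := GRing.isLinear.Build C A2 S7 _ umul
  (tlift_linear umul_linl umul_linr).
HB.instance Definition _ a b := GRing.isLinear.Build C A2 A2 _ (bimod a b)
  (tlift_linear (bimod_linl a b) (bimod_linr a b)).
HB.instance Definition _ := GRing.isLinear.Build C A2 Om _ pi1
  (tlift_linear pi1_linl pi1_linr).

Lemma umul_pure a b : umul (pure a b) = a * b.
Proof. exact: (tlift_pure umul_linl umul_linr). Qed.
Lemma bimod_pure a b p q : bimod a b (pure p q) = pure (a * p) (q * b).
Proof. exact: (tlift_pure (bimod_linl a b) (bimod_linr a b)). Qed.
Lemma pi1_pure a b : pi1 (pure a b) = om0 a * dif (om0 b).
Proof. exact: (tlift_pure pi1_linl pi1_linr). Qed.

Lemma delta_Omega1un a : delta a \in Omega1un.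
Proof. by rewrite unfold_in /delta linearB /= !umul_pure mul1r mulr1 subrr. Qed.

Lemma pi1_delta a b c :
  pi1 (bimod a b (delta c)) = om0 a * dif (om0 c) * om0 b.
Proof.
rewrite /delta linearB /= !bimod_pure linearB /= !pi1_pure !mulr1 mul1r iotaM dif_iotaM.
by rewrite !iotaM mulrDr !mulrA addrK.
Qed.

End Sphere.

(** * The coordinate algebra of SU(2) *)

Inductive su2gen : Type := gw1 | gw1b | gw2 | gw2b.

Section SU2.
Variable R : realType.
Local Notation C := R[i].

Inductive su2rel : term C su2gen -> term C su2gen -> Prop :=
| su2_comm g h : su2rel (tgen g * tgen h)%T (tgen h * tgen g)%T
| su2_det : su2rel (tgen gw1 * tgen gw1b + tgen gw2 * tgen gw2b)%T 1%T.

Definition SU2 : Type := palg su2rel.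

HB.instance Definition _ := GRing.PzRing.on SU2.
HB.instance Definition _ := GRing.Lmodule.on SU2.

Fact su2_mulC : commutative (@GRing.mul SU2).
Proof.
have genC g (y : SU2) : pclass su2rel (tgen g) * y = y * pclass su2rel (tgen g).
  elim/palgW: y; elim=> [h|c|s IHs t IHt|s IHs t IHt].
  - by rewrite -!pclassM; apply/pclassP/cong_rel/su2_comm.
  - by rewrite [RHS](pcstC (rel := su2rel)).
  - by rewrite pclassD mulrDl mulrDr IHs IHt.
  - by rewrite pclassM mulrA IHs -mulrA IHt mulrA.
elim/palgW=> s; elim: s => [g|c|s IHs t IHt|s IHs t IHt] y.
- exact: genC.
- exact: (pcstC (rel := su2rel)).
- by rewrite pclassD mulrDl mulrDr IHs IHt.
- by rewrite pclassM -mulrA IHt mulrA IHs mulrA.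
Qed.

HB.instance Definition _ :=
  GRing.PzRing_hasCommutativeMul.Build SU2 su2_mulC.

Definition w1 : SU2 := pclass su2rel (tgen gw1).
Definition w1b : SU2 := pclass su2rel (tgen gw1b).
Definition w2 : SU2 := pclass su2rel (tgen gw2).
Definition w2b : SU2 := pclass su2rel (tgen gw2b).

Lemma su2_detE : w1 * w1b + w2 * w2b = 1.
Proof.
by rewrite -!pclassM -pclassD; apply/(pclassP su2rel)/cong_rel/su2_det.
Qed.

(* The counit. *)
Definition eps_gen (g : su2gen) : C :=
  match g with gw1 | gw1b => 1 | gw2 | gw2b => 0 end.

Definition eps (h : SU2) : C := plift (@idfun C) eps_gen h.

Fact eps_rel s t : su2rel s t ->
  teval (@idfun C) eps_gen s = teval (@idfun C) eps_gen t.
Proof. by case=> [g h|] /=; rewrite 1?mulrC // mulr1 mulr0 addr0. Qed.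

Fact idfunC (c x : C) : idfun c * x = x * idfun c.
Proof. exact: mulrC. Qed.

Lemma eps_class t : eps (pclass su2rel t) = teval (@idfun C) eps_gen t.
Proof. exact: (plift_class idfunC eps_rel). Qed.
Lemma epsD g h : eps (g + h) = eps g + eps h.
Proof. exact: (pliftD idfunC eps_rel). Qed.
Lemma epsM g h : eps (g * h) = eps g * eps h.
Proof. exact: (pliftM idfunC eps_rel). Qed.
Lemma eps_cst c : eps (pcst su2rel c) = c.
Proof. exact: (plift_cst idfunC eps_rel). Qed.
Lemma epsZ c h : eps (c *: h) = c * eps h.
Proof. by rewrite pscaleE epsM eps_cst. Qed.

(* The basis of A(SU(2)). *)
Definition rbas (k : int) (m n : nat) : SU2 :=
  (-1) ^+ n *: match k with
               | Posz a => w1 ^+ a * w2 ^+ m * w2b ^+ n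
               | Negz b => w2 ^+ m * w2b ^+ n * w1b ^+ b.+1
               end.

(** ** Existence of linear maps defined by recursion on the basis *)

Section Recursion.
Variables (T : lmodType C) (T1 T2 T3 T4 : {linear T -> T}) (e : T).
Hypothesis c31 : forall x, T3 (T1 x) = T1 (T3 x).
Hypothesis c32 : forall x, T3 (T2 x) = T2 (T3 x).
Hypothesis c34 : forall x, T3 (T4 x) = T4 (T3 x).
Hypothesis c41 : forall x, T4 (T1 x) = T1 (T4 x).
Hypothesis c42 : forall x, T4 (T2 x) = T2 (T4 x).

Let M : Type := nat -> nat -> nat -> nat -> T.

Let N4 (x : T) : T := - T4 x.
Let U (x : T) : T := x - T3 (N4 x).

Fact iterC (f g : T -> T) k x :
  (forall y, f (g y) = g (f y)) -> f (iter k g x) = iter k g (f x).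
Proof. by move=> fg; elim: k => //= k IHk; rewrite fg IHk. Qed.

(* The value, at e, of the operator attached to w1^a w1b^b w2^m w2b^n. *)
Definition rec_mon : M := fun a b m n =>
  iter (minn a b) U (iter (a - b) T1 (iter (b - a) T2
    (iter m T3 (iter n N4 e)))).

Let rec_inv (F : M) : Prop :=
  forall a b m n, F a.+1 b.+1 m n + F a b m.+1 n.+1 = F a b m n.

Fact N4_1 x : N4 (T1 x) = T1 (N4 x).
Proof. by rewrite /N4 c41 linearN. Qed.
Fact N4_2 x : N4 (T2 x) = T2 (N4 x).
Proof. by rewrite /N4 c42 linearN. Qed.
Fact N4_3 x : N4 (T3 x) = T3 (N4 x).
Proof. by rewrite /N4 -c34 linearN. Qed.
Fact U_3 x : T3 (U x) = U (T3 x).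
Proof. by rewrite /U linearB /= N4_3. Qed.
Fact U_4 x : N4 (U x) = U (N4 x).
Proof.
have N4B y y' : N4 (y - y') = N4 y - N4 y' by rewrite /N4 linearB opprB opprK addrC.
by rewrite /U N4B N4_3.
Qed.

Fact rec_mon3 a b m n : rec_mon a b m.+1 n = T3 (rec_mon a b m n).
Proof.
rewrite /rec_mon [in RHS](iterC _ _ U_3) (iterC _ _ c31) (iterC _ _ c32).
by [].
Qed.
Fact rec_mon4 a b m n : rec_mon a b m n.+1 = N4 (rec_mon a b m n).
Proof.
rewrite /rec_mon [in RHS](iterC _ _ U_4) (iterC _ _ N4_1) (iterC _ _ N4_2).
by rewrite (iterC _ _ N4_3).
Qed.
Fact rec_mon1 a m n : rec_mon a.+1 0 m n = T1 (rec_mon a 0 m n).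
Proof. by rewrite /rec_mon !minn0 !subn0. Qed.
Fact rec_mon2 b m n : rec_mon 0 b.+1 m n = T2 (rec_mon 0 b m n).
Proof. by rewrite /rec_mon !min0n !subn0. Qed.

Fact rec_mon_inv : rec_inv rec_mon.
Proof.
move=> a b m n; rewrite rec_mon3 rec_mon4.
have -> : rec_mon a.+1 b.+1 m n = U (rec_mon a b m n).
  by rewrite /rec_mon minnSS !subSS.
by rewrite /U subrK.
Qed.

Fixpoint rec_act (t : term C su2gen) (F : M) : M :=
  match t with
  | tgen gw1 => fun a b m n => F a.+1 b m n
  | tgen gw1b => fun a b m n => F a b.+1 m n
  | tgen gw2 => fun a b m n => F a b m.+1 n
  | tgen gw2b => fun a b m n => F a b m n.+1
  | tcst c => fun a b m n => c *: F a b m n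
  | tadd s t => fun a b m n => rec_act s F a b m n + rec_act t F a b m n
  | tmul s t => rec_act s (rec_act t F)
  end.

Fact eqM (F G : M) : (forall a b m n, F a b m n = G a b m n) -> F = G.
Proof. by move=> FG; do 4![apply/funext=> ?]. Qed.

Fact rec_actD t F G : rec_act t (fun a b m n => F a b m n + G a b m n) =
  fun a b m n => rec_act t F a b m n + rec_act t G a b m n.
Proof.
elim: t F G => [[]|c|s IHs t IHt|s IHs t IHt] F G //=; apply: eqM => a b m n.
- by rewrite scalerDr.
- by rewrite IHs IHt addrACA.
- by rewrite IHt IHs.
Qed.

Fact rec_actZ t c F : rec_act t (fun a b m n => c *: F a b m n) =
  fun a b m n => c *: rec_act t F a b m n.
Proof.
elim: t F => [[]|d|s IHs t IHt|s IHs t IHt] F //=; apply: eqM => a b m n.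
- by rewrite !scalerA mulrC.
- by rewrite IHs IHt scalerDr.
- by rewrite IHt IHs.
Qed.

Fact rec_act_inv t F : rec_inv F -> rec_inv (rec_act t F).
Proof.
elim: t F => [[]|d|s IHs t IHt|s IHs t IHt] F iF /= a b m n //.
- by rewrite -scalerDr iF.
- by rewrite addrACA IHs // IHt.
- exact/IHs/IHt.
Qed.

Fact rec_act_cong s t F :
  rec_inv F -> cong su2rel s t -> rec_act s F = rec_act t F.
Proof.
move=> iF st; elim: st F iF => //= {s t}.
- move=> s t [[] [] //|] F iF; apply: eqM => a b m n /=; rewrite scale1r; exact: iF.
- by move=> s t _ E F iF; rewrite E.
- by move=> s t u _ E _ E' F iF; rewrite E // E'.
- by move=> s s' t t' _ E _ E' F iF; rewrite E // E'.
- by move=> s s' t t' _ E _ E' F iF; rewrite E' // E //; apply: rec_act_inv.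
- by move=> s t u F iF; apply: eqM => a b m n; rewrite addrA.
- by move=> s t F iF; apply: eqM => a b m n; rewrite addrC.
- by move=> t F iF; apply: eqM => a b m n; rewrite scale0r add0r.
- move=> t F iF; apply: eqM => a b m n.
  by rewrite scaleN1r addNr scale0r.
- by move=> t F iF; apply: eqM => a b m n; rewrite scale1r.
- move=> t F iF; rewrite rec_actZ; apply: eqM => a b m n; by rewrite scale1r.
- by move=> s t u F iF; rewrite rec_actD.
- by move=> c d F iF; apply: eqM => a b m n; rewrite scalerDl.
- by move=> c d F iF; apply: eqM => a b m n; rewrite scalerA.
- by move=> c t F iF; rewrite rec_actZ.
Qed.

Let pact (x : SU2) : M -> M := rec_act (repr x).

Fact pact_class t F : rec_inv F -> pact (pclass su2rel t) F = rec_act t F.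
Proof. by move=> iF; apply: (rec_act_cong iF); apply: repr_pclass. Qed.

Fact pact_inv x F : rec_inv F -> rec_inv (pact x F).
Proof. exact: rec_act_inv. Qed.

Fact pactM x y F : rec_inv F -> pact (x * y) F = pact x (pact y F).
Proof.
move=> iF; elim/palgW: x => s; elim/palgW: y => t.
by rewrite -pclassM !pact_class //; apply: rec_act_inv.
Qed.

Fact pactX (x : SU2) k F : rec_inv F -> pact (x ^+ k) F = iter k (pact x) F.
Proof.
move=> iF; have iI j : rec_inv (iter j (pact x) F).
  by elim: j => //= j; apply: pact_inv.
elim: k => [|k IHk].
  rewrite expr0 (pact_class (tcst 1)) //; apply: eqM => a b m n /=.
  exact: scale1r.
by rewrite exprS pactM // IHk.
Qed.

Fact pact_w1 k F : rec_inv F ->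
  pact (w1 ^+ k) F = fun a b m n => F (k + a)%N b m n.
Proof.
move=> iF; rewrite pactX //; elim: k F iF => //= k IHk F iF.
rewrite IHk // pact_class /=; first by apply: eqM => a b m n; rewrite addnS.
by move=> *; rewrite addnS; apply: iF.
Qed.
Fact pact_w1b k F : rec_inv F ->
  pact (w1b ^+ k) F = fun a b m n => F a (k + b)%N m n.
Proof.
move=> iF; rewrite pactX //; elim: k F iF => //= k IHk F iF.
rewrite IHk // pact_class /=; first by apply: eqM => a b m n; rewrite addnS.
by move=> *; rewrite addnS; apply: iF.
Qed.
Fact pact_w2 k F : rec_inv F ->
  pact (w2 ^+ k) F = fun a b m n => F a b (k + m)%N n.
Proof.
move=> iF; rewrite pactX //; elim: k F iF => //= k IHk F iF.
rewrite IHk // pact_class /=; first by apply: eqM => a b m n; rewrite addnS.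
by move=> *; rewrite addnS; apply: iF.
Qed.
Fact pact_w2b k F : rec_inv F ->
  pact (w2b ^+ k) F = fun a b m n => F a b m (k + n)%N.
Proof.
move=> iF; rewrite pactX //; elim: k F iF => //= k IHk F iF.
rewrite IHk // pact_class /=; first by apply: eqM => a b m n; rewrite addnS.
by move=> *; rewrite addnS; apply: iF.
Qed.

Let rec_map (x : SU2) : T := pact x rec_mon 0 0 0 0.

Fact rec_map_linear : linear rec_map.
Proof.
move=> c; elim/palgW=> s; elim/palgW=> t; rewrite /rec_map.
by rewrite -pclassZ -pclassD !(pact_class _ rec_mon_inv).
Qed.

HB.instance Definition _ := GRing.isLinear.Build C SU2 T _ rec_map rec_map_linear.

Fact rec_map_pos a m n :
  rec_map (rbas (Posz a) m n) = (-1) ^+ n *: rec_mon a 0 m n.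
Proof.
have i0 := rec_mon_inv.
rewrite /rbas linearZ /=; congr (_ *: _); rewrite /rec_map.
have i1 := pact_inv (w2b ^+ n) i0; have i2 := pact_inv (w2 ^+ m) i1.
rewrite !pactM // pact_w1 // pact_w2 // pact_w2b //.
by rewrite !addn0.
Qed.

Fact rec_map_neg b m n :
  rec_map (rbas (Negz b) m n) = (-1) ^+ n *: rec_mon 0 b.+1 m n.
Proof.
have i0 := rec_mon_inv.
rewrite /rbas linearZ /=; congr (_ *: _); rewrite /rec_map.
have i1 := pact_inv (w1b ^+ b.+1) i0; have i2 := pact_inv (w2b ^+ n) i1.
rewrite !pactM // pact_w2 // pact_w2b // pact_w1b //.
by rewrite !addn0.
Qed.

Lemma rec_exists : exists f : {linear SU2 -> T},
  [/\ f 1 = e,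
      forall k m n, 0 <= k -> f (rbas (k + 1) m n) = T1 (f (rbas k m n)),
      forall k m n, k <= 0 -> f (rbas (k - 1) m n) = T2 (f (rbas k m n)),
      forall k m n, f (rbas k m.+1 n) = T3 (f (rbas k m n)) &
      forall k m n, f (rbas k m n.+1) = T4 (f (rbas k m n))].
Proof.
exists rec_map; split=> /=.
- have -> : 1 = rbas 0 0 0 by rewrite /rbas /= !expr0 scale1r !mulr1.
  by rewrite [LHS]rec_map_pos scale1r.
- case=> // a m n _; rewrite -PoszD addn1 [LHS]rec_map_pos rec_mon1.
  by rewrite [in RHS]rec_map_pos linearZ.
- case=> [[|//]|b] m n _.
    rewrite sub0r [LHS]rec_map_neg [in RHS]rec_map_pos linearZ /=.
    by rewrite rec_mon2.
  have -> : Negz b - 1 = Negz b.+1 by rewrite !NegzE -opprD -PoszD addn1.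
  by rewrite [LHS]rec_map_neg rec_mon2 [in RHS]rec_map_neg linearZ.
- case=> [a|b] m n.
    by rewrite [LHS]rec_map_pos rec_mon3 [in RHS]rec_map_pos linearZ.
  by rewrite [LHS]rec_map_neg rec_mon3 [in RHS]rec_map_neg linearZ.
- case=> [a|b] m n.
    rewrite [LHS]rec_map_pos rec_mon4 [in RHS]rec_map_pos linearZ /=.
    by rewrite /N4 exprS mulN1r scaleNr scalerN opprK.
  rewrite [LHS]rec_map_neg rec_mon4 [in RHS]rec_map_neg linearZ /=.
  by rewrite /N4 exprS mulN1r scaleNr scalerN opprK.
Qed.

End Recursion.

End SU2.

(** * Symmetric tensors and the representation on Sym^n(C^2) *)

(* The components of u^{(x)(n-k)} (x)_S v^{(x)k}: a distinct ordering is given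
   by the set of the k positions of v. *)
Definition symt (B : pzRingType) (d n : nat) (u v : 'I_d -> B) (k : nat)
    (J : {ffun 'I_n -> 'I_d}) : B :=
  \sum_(S : {set 'I_n} | #|S| == k)
    \prod_(s < n) (if s \in S then v else u) (J s).

Section Representation.
Variables (R : realType) (n : nat).
Local Notation C := R[i].
Local Notation SU2 := (SU2 R).

(* Indices k = 1, ..., n + 1 are shifted to k = 0, ..., n: this is a_{k+1}. *)
Definition anorm (k : nat) : R := Num.sqrt ('C(n, k))%:R.

Definition ebas (k : nat) (J : {ffun 'I_n -> 'I_2}) : C :=
  ((anorm k)^-1)%:C%C *
  symt (fun i : 'I_2 => (i == 0)%:R) (fun i : 'I_2 => (i == 1)%:R) k J.

Definition wmat : 'M[SU2]_2 :=
  \matrix_(i, j) (if i == 0 then if j == 0 then w1 R else w2 R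
                  else if j == 0 then - w2b R else w1b R).

(* w^{(x)n} v, for a tensor v with scalar components. *)
Definition rho (v : {ffun 'I_n -> 'I_2} -> C) (I : {ffun 'I_n -> 'I_2}) : SU2 :=
  \sum_(J : {ffun 'I_n -> 'I_2}) v J *: \prod_(s < n) wmat (I s) (J s).

Definition rho_spec (E : 'M[SU2]_n.+1) : Prop :=
  forall (l : 'I_n.+1) I, rho (ebas l) I = \sum_(k < n.+1) ebas k I *: E k l.

Let ones (I : {ffun 'I_n -> 'I_2}) : {set 'I_n} := [set s | I s == 1].

Fact ones_perm (I J : {ffun 'I_n -> 'I_2}) : #|ones I| = #|ones J| ->
  exists p : {perm 'I_n}, forall s, J s = I (p s).
Proof.
move=> IJ.
have cnt (K : {ffun 'I_n -> 'I_2}) (i : 'I_2) :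
    count_mem i [tuple K s | s < n] = #|[set s | K s == i]|.
  by rewrite count_map -size_filter cardE /enum_mem -enumT; congr size;
     apply: eq_filter => s; rewrite !inE.
have zeros (K : {ffun 'I_n -> 'I_2}) :
    #|[set s | K s == 0]| = (n - #|ones K|)%N.
  have -> : [set s | K s == 0] = ~: ones K.
    by apply/setP=> s; rewrite !inE; case: (K s) => [[|[|//]]].
  by rewrite cardsCs setCK card_ord.
have /tuple_permP[p pE] : perm_eq [tuple J s | s < n] [tuple I s | s < n].
  apply/allP=> i _ /=; rewrite !cnt.
  have [->|->] : i = 0 \/ i = 1.
  - by case: i => [[|[|//]]] ?; [left|right]; apply: val_inj.
  - by rewrite (zeros J) (zeros I) IJ.
  - by rewrite -/(ones I) -/(ones J) IJ.
exists p => s.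
have := congr1 (fun q => nth 0 q s) pE.
by rewrite -!tnth_nth !tnth_mktuple.
Qed.

Fact ebasE k J : ebas k J = if #|ones J| == k then ((anorm k)^-1)%:C%C else 0.
Proof.
rewrite /ebas /symt (_ : \sum_(S | _) _ = (#|ones J| == k)%:R); last first.
  have term0 (S : {set 'I_n}) : S != ones J ->
      \prod_(s < n) (if s \in S then fun i : 'I_2 => (i == 1)%:R
                     else fun i : 'I_2 => (i == 0)%:R) (J s) = 0 :> C.
    move=> SJ; have [s sS] : exists s, (s \in S) != (s \in ones J).
      by apply/existsP; apply: contraR SJ; rewrite negb_exists => /forallP e;
         apply/eqP/setP => s; apply/eqP; rewrite -[_ == _]negbK.
    rewrite (bigD1 s) //=; move: sS; rewrite inE.
    case: (s \in S); case: (J s) => [[|[|//]]] ? //= _; by rewrite mul0r.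
  have term1 : \prod_(s < n) (if s \in ones J then fun i : 'I_2 => (i == 1)%:R
                     else fun i : 'I_2 => (i == 0)%:R) (J s) = 1 :> C.
    rewrite big1 // => s _; rewrite inE; case: eqP => [->//|].
    by case: (J s) => [[|[|//]]] ? // []; apply: val_inj.
  case: eqP => [cJ|cJ].
    rewrite (bigD1 (ones J)) ?cJ ?eqxx //= term1 big1 ?addr0 // => S /andP[_].
    exact: term0.
  by rewrite big1 // => S /eqP cS; apply: term0; apply/eqP => E; apply: cJ; rewrite -E.
by case: eqP => _; rewrite ?mulr1 ?mulr0.
Qed.

Fact rho_ebas_perm k (I J : {ffun 'I_n -> 'I_2}) :
  #|ones I| = #|ones J| -> rho (ebas k) I = rho (ebas k) J.
Proof.
move=> /ones_perm[p pE].
have pi_bij : bijective (fun K : {ffun 'I_n -> 'I_2} => [ffun s => K (p s)]).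
  exists (fun K : {ffun 'I_n -> 'I_2} => [ffun s => K ((p^-1)%g s)]) => K;
    by apply/ffunP => s; rewrite !ffunE ?permK ?permKV.
rewrite /rho [RHS](reindex _ (onW_bij _ pi_bij)) /=.
apply: eq_bigr => K _; congr (_ *: _).
  rewrite !ebasE; congr (if _ == _ then _ else _).
  rewrite -[RHS](card_imset _ (@perm_inj _ p)); congr #|pred_of_set _|.
  apply/setP=> s; apply/idP/imsetP => [sK|[t tK ->]].
    exists ((p^-1)%g s); rewrite ?permKV // !inE ffunE permKV.
    by move: sK; rewrite inE.
  by move: tK; rewrite !inE ffunE.
rewrite (reindex_inj (@perm_inj _ p)) /=; apply: eq_bigr => s _.
by rewrite ffunE pE.
Qed.

Fact anorm_neq0 k : (k <= n)%N -> anorm k != 0.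
Proof. by move=> kn; rewrite gt_eqF // sqrtr_gt0 ltr0n bin_gt0. Qed.

Lemma rho_coef_exists : exists E, rho_spec E.
Proof.
pose I_ (k : nat) : {ffun 'I_n -> 'I_2} :=
  [ffun s : 'I_n => if (s < k)%N then 1 else 0].
have cI k : (k <= n)%N -> #|ones (I_ k)| = k.
  move=> kn; have winj : injective (widen_ord kn).
    by move=> a b /(congr1 val) /= ab; apply: val_inj.
  rewrite -[RHS]card_ord -(card_imset _ winj).
  apply: eq_card => s; rewrite inE ffunE; apply/idP/imsetP.
    by case: ltnP => // sk _; exists (Ordinal sk) => //; apply: val_inj.
  by case=> t _ ->; rewrite /= ltn_ord.
exists (\matrix_(k, l) ((anorm k)%:C%C *: rho (ebas l) (I_ k))) => l I.
have cn : (#|ones I| < n.+1)%N by rewrite ltnS -[X in (_ <= X)%N]card_ord max_card.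
rewrite (bigD1 (Ordinal cn)) //= big1 ?addr0 => [|k kc].
  rewrite mxE ebasE eqxx scalerA -rmorphM /= mulVf ?anorm_neq0 // scale1r.
  by apply: rho_ebas_perm; rewrite cI.
rewrite ebasE ifN ?scale0r //; apply: contra kc => /eqP kE.
by apply/eqP/val_inj.
Qed.

(* The matrix coefficients of rho_n in the basis e_k. *)
Definition rho_coef : 'M[SU2]_n.+1 := sval (cid rho_coef_exists).

Lemma rho_coefP : rho_spec rho_coef.
Proof. exact: (svalP (cid rho_coef_exists)). Qed.

End Representation.

(** * Kets, the map ell and the connection one-form *)

Section Connection.
Variables (R : realType) (theta : R).
Local Notation C := R[i].
Local Notation S7 := (S7 theta).
Local Notation z := (z theta).
Local Notation zb := (zb theta).
Local Notation star := (@star R theta).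
Local Notation bimod := (@bimod R theta).
Local Notation A2 := (tensor S7 S7).

Definition psi1 : 'I_4 -> S7 := tnth [tuple z i1; - zb i2; z i3; - zb i4].
Definition psi2 : 'I_4 -> S7 := tnth [tuple z i2; zb i1; z i4; zb i3].

(* phi n k is phi_{k+1}. *)
Definition phi (n k : nat) (J : {ffun 'I_n -> 'I_4}) : S7 :=
  ((anorm R n k)^-1)%:C%C *: symt psi1 psi2 k J.

(* <xi|d eta>. *)
Definition braket_d (n : nat) (xi eta : {ffun 'I_n -> 'I_4} -> S7) : Om theta :=
  \sum_(J : {ffun 'I_n -> 'I_4}) om0 (star (xi J)) * dif (om0 (eta J)).

(* The connection one-form of p_(n) o d. *)
Definition conn_form (n : nat) (k l : 'I_n.+1) : Om theta :=
  braket_d (@phi n k) (@phi n l).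

Definition one2 : A2 := pure (1 : S7) (1 : S7).

Definition ell_spec (f : SU2 R -> A2) : Prop :=
  [/\ f 1 = one2,
      forall (k : int) m n, 0 <= k -> f (rbas R (k + 1) m n) =
        bimod (zb i1) (z i1) (f (rbas R k m n)) +
        bimod (z i2) (zb i2) (f (rbas R k m n)) +
        bimod (zb i3) (z i3) (f (rbas R k m n)) +
        bimod (z i4) (zb i4) (f (rbas R k m n)),
      forall (k : int) m n, k <= 0 -> f (rbas R (k - 1) m n) =
        bimod (zb i2) (z i2) (f (rbas R k m n)) +
        bimod (z i1) (zb i1) (f (rbas R k m n)) +
        bimod (zb i4) (z i4) (f (rbas R k m n)) +
        bimod (z i3) (zb i3) (f (rbas R k m n)),
      forall (k : int) m n, f (rbas R k m.+1 n) =
        bimod (zb i1) (z i2) (f (rbas R k m n)) -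
        bimod (z i2) (zb i1) (f (rbas R k m n)) +
        bimod (zb i3) (z i4) (f (rbas R k m n)) -
        bimod (z i4) (zb i3) (f (rbas R k m n)) &
      forall (k : int) m n, f (rbas R k m n.+1) =
        bimod (zb i2) (z i1) (f (rbas R k m n)) -
        bimod (z i1) (zb i2) (f (rbas R k m n)) +
        bimod (zb i4) (z i3) (f (rbas R k m n)) -
        bimod (z i3) (zb i4) (f (rbas R k m n))].

(** ** Existence of ell *)

(* The recursion operators are x |-> <psi_a| x |psi_b>; [pgen a j] is the
   generator, up to sign, in position j of psi_a. *)
Let pgen (a : bool) (j : 'I_4) : s7gen :=
  if a then tnth [tuple gz i1; gzb i2; gz i3; gzb i4] j
  else tnth [tuple gz i2; gzb i1; gz i4; gzb i3] j.
Let psgn (a : bool) (j : 'I_4) : C := if a && odd j then -1 else 1.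
Let cl (g : s7gen) : S7 := pclass (s7rel theta) (tgen g).
Let phase (g h : s7gen) : C :=
  match g, h with
  | gz i, gz j => lambda' theta i j
  | gzb i, gz j => lambda' theta j i
  | gz i, gzb j => lambda' theta j i
  | gzb i, gzb j => lambda' theta i j
  end.
Let rop (a b : bool) (x : A2) : A2 :=
  \sum_j (psgn a j * psgn b j) *: bimod (cl (s7bar (pgen a j))) (cl (pgen b j)) x.

Fact rop_linear a b : linear (rop a b).
Proof.
move=> c x y; rewrite /rop scaler_sumr -big_split /=; apply: eq_bigr => j _.
by rewrite linearP scalerDr !scalerA mulrC.
Qed.
HB.instance Definition _ a b := GRing.isLinear.Build C A2 A2 _ (rop a b)
  (rop_linear a b).

Fact cl_phase g h : cl g * cl h = phase g h *: (cl h * cl g).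
Proof.
by case: g h => [i|i] [j|j]; [exact: zzE|exact: zzbE|exact: zbzE|exact: zbzbE].
Qed.

Fact bimodM a b p q x : bimod a b (bimod p q x) = bimod (a * p) (q * b) x.
Proof.
elim/tensor_ind: x => [|v w|x y IHx IHy|c x IHx].
- by rewrite !linear0.
- by rewrite !bimod_pure !mulrA.
- by rewrite !linearD /= IHx IHy.
- by rewrite !linearZ /= IHx.
Qed.

Fact bimodZ c d a b x : bimod (c *: a) (d *: b) x = (c * d) *: bimod a b x.
Proof.
elim/tensor_ind: x => [|v w|x y IHx IHy|e x IHx].
- by rewrite !linear0 ?scaler0.
- rewrite !bimod_pure -[in LHS]pscaleAl -[in LHS]pscaleAr pureZl pureZr.
  by rewrite scalerA.
- by rewrite !linearD /= IHx IHy ?scalerDr.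
- by rewrite [LHS]linearZ [in RHS]linearZ /= IHx !scalerA mulrC.
Qed.

Fact phase_pgen a b j k : phase (pgen a j) (pgen b k) = phase (pgen true j) (pgen true k).
Proof.
case: a b => [] [] //; rewrite /pgen.
all: case: j => [[|[|[|[|//]]]] ?]; case: k => [[|[|[|[|//]]]] ?].
all: by rewrite !(tnth_nth (gz i1)).
Qed.

Fact phase_bar g h : phase (s7bar g) (s7bar h) = phase g h.
Proof. by case: g h => [i|i] [j|j]. Qed.

Fact phaseV g h : phase g h * phase h g = 1.
Proof. by case: g h => [i|i] [j|j]; rewrite /= ?lambda'_inv. Qed.

Fact ropC a b c d x : rop a b (rop c d x) = rop c d (rop a b x).
Proof.
have E a' b' c' d' : rop a' b' (rop c' d' x) =
    \sum_j \sum_k (psgn a' j * psgn b' j * (psgn c' k * psgn d' k)) *: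
      bimod (cl (s7bar (pgen a' j)) * cl (s7bar (pgen c' k)))
            (cl (pgen d' k) * cl (pgen b' j)) x.
  rewrite /rop; apply: eq_bigr => j _; rewrite linear_sum scaler_sumr /=.
  by apply: eq_bigr => k _; rewrite linearZ scalerA /= bimodM.
rewrite !E exchange_big; apply: eq_bigr => j _; apply: eq_bigr => k _ /=.
rewrite [X in bimod X _]cl_phase [X in bimod _ X]cl_phase bimodZ.
rewrite phase_bar (phase_pgen a c) (phase_pgen d b) phaseV scale1r.
by rewrite [X in X *: _]mulrC.
Qed.

Lemma ell_exists : exists f : {linear SU2 R -> A2}, ell_spec f.
Proof.
have [f [f1 f2 f3 f4 f5]] := @rec_exists R A2 (rop true true) (rop false false)
  (rop true false) (rop false true) one2 (ropC _ _ _ _) (ropC _ _ _ _)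
  (ropC _ _ _ _) (ropC _ _ _ _) (ropC _ _ _ _).
have ropE a b x : rop a b x =
    (psgn a i1 * psgn b i1) *: bimod (cl (s7bar (pgen a i1))) (cl (pgen b i1)) x +
    (psgn a i2 * psgn b i2) *: bimod (cl (s7bar (pgen a i2))) (cl (pgen b i2)) x +
    (psgn a i3 * psgn b i3) *: bimod (cl (s7bar (pgen a i3))) (cl (pgen b i3)) x +
    (psgn a i4 * psgn b i4) *: bimod (cl (s7bar (pgen a i4))) (cl (pgen b i4)) x.
  have e1 : ord0 = i1 by apply: val_inj.
  have e2 : lift ord0 ord0 = i2 by apply: val_inj.
  have e3 : lift ord0 (lift ord0 ord0) = i3 by apply: val_inj.
  have e4 : lift ord0 (lift ord0 (lift ord0 ord0)) = i4 by apply: val_inj.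
  by rewrite /rop !big_ord_recl big_ord0 addr0 !addrA e4 e3 e2 e1.
have sgnE : [/\ (forall j, psgn false j = 1), psgn true i1 = 1, psgn true i2 = -1,
    psgn true i3 = 1 & psgn true i4 = -1] by split.
case: sgnE => s0 s1 s2 s3 s4.
have pE : [/\ pgen true i1 = gz i1, pgen true i2 = gzb i2, pgen true i3 = gz i3
    & pgen true i4 = gzb i4] by split; rewrite /pgen !(tnth_nth (gz i1)).
have pE' : [/\ pgen false i1 = gz i2, pgen false i2 = gzb i1,
    pgen false i3 = gz i4 & pgen false i4 = gzb i3].
  by split; rewrite /pgen !(tnth_nth (gz i1)).
case: pE pE' => p1 p2 p3 p4 [q1 q2 q3 q4].
exists f; split=> //.
- move=> k m n k0; rewrite f2 //= ropE p1 p2 p3 p4 s1 s2 s3 s4.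
  by rewrite mulrNN !mulr1 !scale1r.
- move=> k m n k0; rewrite f3 //= ropE q1 q2 q3 q4 !s0.
  by rewrite !mulr1 !scale1r.
- move=> k m n; rewrite f4 //= ropE p1 p2 p3 p4 q1 q2 q3 q4 !s0 s1 s2 s3 s4.
  by rewrite !mulr1 !scale1r !scaleN1r.
- move=> k m n; rewrite f5 //= ropE p1 p2 p3 p4 q1 q2 q3 q4 !s0 s1 s2 s3 s4.
  by rewrite !mul1r !scale1r !scaleN1r.
Qed.

Definition ell : {linear SU2 R -> A2} := sval (cid ell_exists).

Lemma ellP : ell_spec ell.
Proof. exact: (svalP (cid ell_exists)). Qed.

Definition omega (h : SU2 R) : A2 := ell h - eps h *: one2.

End Connection.

(* Main.v *)
Require Import Defs.
From HB Require Import structures.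
From mathcomp Require Import all_boot all_order all_algebra.
From mathcomp Require Import boolp reals trigo complex.
From mathcomp Require Import ring.

(** The recursion that defines [ell] consists of the operators
      x |-> sum_j <psi_a|_j x |psi_b>_j      (a, b = 1, 2)
    on the tensor square of the sphere algebra (below [rop]), one for each
    entry w_ab of the fundamental matrix of SU(2). Write m for the
    multiplication and A_ab = <psi_a|d psi_b>. When m(x) is a scalar and the
    form pi(x) commutes with functions, orthonormality of the kets and the
    Leibniz rule give
      m (rop a b x) = delta_ab m(x),
      pi (rop a b x) = delta_ab pi(x) + m(x) A_ab
    ([umul_rop], [pi1_rop]). The first formula makes m o ell the counit
    ([umul_ell]), which is the first claim. The second one can be iterated
    because the forms A_ab commute with functions ([central_aform]): the j-th
    components of psi_1 and psi_2 pick up the same phase when exchanged with a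
    generator, and <psi_a|_j picks up the inverse one.

    The operators do not satisfy the determinant relation
    w1 w1b + w2 w2b = 1 on the tensor square, so multiplication by w_ab
    corresponds to rop a b only along the steps of the recursion. After pi the
    defect is A_11 + A_22, and this is the differential of
    sum_i z_i zb_i = 1, hence 0 ([aform_trace]). Therefore pi o ell is a
    derivation over the counit, determined by w_ab |-> A_ab ([aell_wmat]).

    Expand phi_k on the words Psi_I = psi_(I 1) (x) ... (x) psi_(I n), with the
    scalar components of e_k as coefficients ([phi_psiw]). The tensor
    sum_J Psi_I(J)^* (x) Psi_I'(J) is obtained from 1 (x) 1 by applying the
    operators of the letters (I s, I' s), innermost letter first ([ketbraS]),
    so pi sends it to the value of pi o ell on the product of the w_(I s)(I' s)
    ([ketbra_word]). Orthonormality of the e_k expresses the coefficient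
    e^(n)_kl through the same words and the same scalars ([aell_rho_coef],
    [conn_form_words]), whence the second claim. *)

Set Implicit Arguments.
Unset Strict Implicit.
Unset Printing Implicit Defensive.

Import Order.TTheory GRing.Theory Num.Theory.
Local Open Scope ring_scope.

(** * Kets and the recursion operators on the sphere *)

Section Forms.
Variables (R : realType) (theta : R).
Local Notation C := R[i].
Local Notation S7 := (S7 theta).
Local Notation Om := (Om theta).
Local Notation A2 := (tensor S7 S7).
Local Notation z := (z theta).
Local Notation zb := (zb theta).
Local Notation bimod := (@bimod R theta).
Local Notation umul := (@umul R theta).
Local Notation pi1 := (@pi1 R theta).
Local Notation om0 := (@om0 R theta).
Local Notation dif := (@dif R theta).
Local Notation star := (@star R theta).

Fact om0_nmod_morphism : nmod_morphism om0.
Proof. by split; [exact: (iota_cst theta 0)|exact: Defs.iotaD]. Qed.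
Fact om0_monoid_morphism : monoid_morphism om0.
Proof. by split; [exact: (iota_cst theta 1)|exact: iotaM]. Qed.
HB.instance Definition _ :=
  GRing.isNmodMorphism.Build S7 Om om0 om0_nmod_morphism.
HB.instance Definition _ :=
  GRing.isMonoidMorphism.Build S7 Om om0 om0_monoid_morphism.

Fact dif_linear : linear dif.
Proof. by move=> c x y; rewrite difD difZ. Qed.
HB.instance Definition _ := GRing.isLinear.Build C Om Om _ dif dif_linear.

Lemma dif1 : dif 1 = 0.
Proof. exact: (dif_class theta (tcst 1)). Qed.

Lemma star0 : star 0 = 0.
Proof. by rewrite (star_class theta (tcst 0)) /= rmorph0. Qed.

Lemma star1 : star 1 = 1.
Proof. by rewrite (star_class theta (tcst 1)) /= rmorph1. Qed.

Definition psi (a : 'I_2) : 'I_4 -> S7 := if a == 0 then psi1 theta else psi2 theta.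

(** The connection form of the fundamental representation, <psi_a|d psi_b>. *)
Definition aform (a b : 'I_2) : Om := \sum_j om0 (star (psi a j)) * dif (om0 (psi b j)).

(** The operator x |-> <psi_a| x |psi_b>, through which [ell] is defined. *)
Definition rop (a b : 'I_2) (x : A2) : A2 :=
  \sum_j bimod (star (psi a j)) (psi b j) x.

Lemma psiE : [/\ psi 0 =1 tnth [tuple z i1; - zb i2; z i3; - zb i4]
  & psi 1 =1 tnth [tuple z i2; zb i1; z i4; zb i3]].
Proof. by []. Qed.

Lemma starN (x : S7) : star (- x) = - star x.
Proof. by rewrite -[- x]scaleN1r starZ rmorphN rmorph1 scaleN1r. Qed.

Lemma starpsiE : [/\ (fun j => star (psi 0 j)) =1
    tnth [tuple zb i1; - z i2; zb i3; - z i4]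
  & (fun j => star (psi 1 j)) =1 tnth [tuple zb i2; z i1; zb i4; z i3]].
Proof.
by split=> [] [[|[|[|[|//]]]] j]; 
  rewrite /psi /= /psi1 /psi2 !(tnth_nth 0) /= ?starN ?star_z ?star_zb.
Qed.

Lemma sum4 (V : zmodType) (F : 'I_4 -> V) : \sum_j F j = F i1 + F i2 + F i3 + F i4.
Proof.
rewrite !big_ord_recl big_ord0 addr0 !addrA.
by congr (_ + F _ + F _ + F _); try congr (F _); apply: val_inj.
Qed.

Lemma I2P (P : 'I_2 -> Prop) : P 0 -> P 1 -> forall a, P a.
Proof.
by move=> P0 P1 [[|[|//]] ia]; [have := P0|have := P1]; congr P; apply: val_inj.
Qed.

Lemma lambda'_same (i j : 'I_4) : (i < 2)%N = (j < 2)%N -> lambda' theta i j = 1.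
Proof. by rewrite /lambda' => ->; rewrite eqxx. Qed.

Lemma zbz_same (i j : 'I_4) : (i < 2)%N = (j < 2)%N -> zb i * z j = z j * zb i.
Proof. by move=> ij; rewrite zbzE lambda'_same // scale1r. Qed.

(** Orthonormality only needs the commutation of generators whose indices lie
    in the same block {1, 2} or {3, 4}, where all phases are 1. *)
Lemma psi_orth a b : \sum_j star (psi a j) * psi b j = (a == b)%:R.
Proof.
have [s0 s1] := starpsiE; have [p0 p1] := psiE.
have sz := sum_zzb theta; rewrite sum4 in sz.
elim/I2P: a; elim/I2P: b; rewrite sum4 ?s0 ?s1 ?p0 ?p1 !(tnth_nth 0) /=.
all: rewrite ?mulrN ?mulNr ?opprK !zbz_same //.
- by rewrite addrN add0r addrN.
- by rewrite addrN add0r addrN.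
- by rewrite -sz [z i2 * _ + _]addrC -!addrA [z i4 * _ + _]addrC !addrA.
Qed.

(** The scalar in g h = phase g h *: h g; the same scalar governs g dh. *)
Definition phase (g h : s7gen) : C :=
  match g, h with
  | gz i, gz j | gzb i, gzb j => lambda' theta i j
  | gzb i, gz j | gz i, gzb j => lambda' theta j i
  end.

Definition gen (g : s7gen) : S7 := pclass (s7rel theta) (tgen g).

Lemma om0_gen g : om0 (gen g) = pclass (omrel theta) (tgen (gf g)).
Proof. exact: iota_class. Qed.

Lemma dif_gen g : dif (om0 (gen g)) = pclass (omrel theta) (tgen (gd g)).
Proof. by rewrite om0_gen; exact: (dif_class theta (tgen (gf g))). Qed.

Lemma gen_comm g h : gen g * gen h = phase g h *: (gen h * gen g).
Proof.
by case: g h => [i|i] [j|j]; [exact: zzE|exact: zzbE|exact: zbzE|exact: zbzbE].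
Qed.

(** The relation between z_i and dzb_j is listed as the adjoint of the
    one between zb_i and dz_j, with the factors in the opposite order. *)
Lemma gen_dif_comm g h :
  om0 (gen g) * dif (om0 (gen h)) = phase g h *: (dif (om0 (gen h)) * om0 (gen g)).
Proof.
rewrite om0_gen dif_gen; case: g h => [i|i] [j|j]; rewrite -!pclassM.
- by rewrite (omE (om_zdz theta i j)) pclassZ.
- rewrite (omE (om_zbdz_adj theta i j)) pclassZ scalerA conj_lambda' lambda'_inv.
  by rewrite scale1r.
- by rewrite (omE (om_zbdz theta i j)) pclassZ.
- by rewrite (omE (om_zbdzb theta i j)) pclassZ.
Qed.

Lemma phaseV g h : phase g (s7bar h) * phase g h = 1.
Proof. by case: g h => [i|i] [j|j] /=; rewrite lambda'_inv. Qed.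

Definition pgen (a : 'I_2) (j : 'I_4) : s7gen :=
  if a == 0 then tnth [tuple gz i1; gzb i2; gz i3; gzb i4] j
  else tnth [tuple gz i2; gzb i1; gz i4; gzb i3] j.

Definition psgn (a : 'I_2) (j : 'I_4) : C := if (a == 0) && odd j then -1 else 1.

Lemma psi_gen a j : psi a j = psgn a j *: gen (pgen a j).
Proof.
elim/I2P: a; rewrite /psi /pgen /psgn /= /psi1 /psi2;
  by case: j => [[|[|[|[|//]]]] ij] /=; rewrite !(tnth_nth 0) !(tnth_nth (gz i1)) /=
  ?scale1r ?scaleN1r.
Qed.

Lemma star_gen g : star (gen g) = gen (s7bar g).
Proof. exact: star_class. Qed.

Lemma starpsi_gen a j : star (psi a j) = psgn a j *: gen (s7bar (pgen a j)).
Proof.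
rewrite psi_gen starZ star_gen /psgn; congr (_ *: _).
by case: ifP; rewrite ?rmorphN rmorph1.
Qed.

(** Components with the same index of psi_1 and psi_2 have the same weight
    under the torus action that deforms the sphere. *)
Lemma phase_pgen g a b j : phase g (pgen a j) = phase g (pgen b j).
Proof.
suff E c : phase g (pgen c j) = phase g (pgen 0 j) by rewrite E [RHS]E.
elim/I2P: c => //; rewrite /pgen /=.
by case: j => [[|[|[|[|//]]]] ij]; rewrite !(tnth_nth (gz i1)) /=;
  case: g => -[[|[|[|[|//]]]] ik].
Qed.

Definition central_form (y : Om) : Prop := forall x, om0 x * y = y * om0 x.

Lemma central_formW y :
  (forall g, om0 (gen g) * y = y * om0 (gen g)) -> central_form y.
Proof.
move=> cy; elim/palgW; elim=> [g|c|s IHs t IHt|s IHs t IHt].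
- exact: cy.
- by rewrite (iota_cst theta c) pcstC.
- by rewrite pclassD rmorphD mulrDl mulrDr IHs IHt.
- by rewrite pclassM rmorphM -mulrA IHt mulrA IHs mulrA.
Qed.

Lemma central_form0 : central_form 0.
Proof. by move=> x; rewrite mul0r mulr0. Qed.

Lemma central_formD y y' : central_form y -> central_form y' -> central_form (y + y').
Proof. by move=> cy cy' x; rewrite mulrDr mulrDl cy cy'. Qed.

Lemma central_formZ c y : central_form y -> central_form (c *: y).
Proof. by move=> cy x; rewrite -pscaleAr -pscaleAl cy. Qed.

(** Moving g past <psi_a|_j and then past d(psi_b)_j yields two phases that are
    inverse to each other. *)
Lemma central_aform a b : central_form (aform a b).
Proof.
apply: central_formW => g; rewrite /aform mulr_sumr mulr_suml.
apply: eq_bigr => j _; rewrite starpsi_gen psi_gen !iotaZ difZ.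
rewrite -!(pscaleAl, pscaleAr); congr (_ *: (_ *: _)).
rewrite mulrA -iotaM gen_comm iotaZ iotaM -pscaleAl -[in LHS]mulrA gen_dif_comm.
by rewrite -pscaleAr scalerA (phase_pgen _ b a) phaseV scale1r mulrA.
Qed.

Lemma umul_bimod a b x : umul (bimod a b x) = a * umul x * b.
Proof.
elim/tensor_ind: x => [|v w|x y IHx IHy|c x IHx].
- by rewrite !linear0 mulr0 mul0r.
- by rewrite bimod_pure !umul_pure !mulrA.
- by rewrite !linearD /= IHx IHy mulrDr mulrDl.
- by rewrite !linearZ /= IHx -pscaleAr -pscaleAl.
Qed.

(** Since a (p (x) q) b is sent to a p d(q b), the failure of pi to be a
    bimodule map is the Leibniz term a p q db. *)
Lemma pi1_bimod a b x :
  pi1 (bimod a b x) = om0 a * pi1 x * om0 b + om0 (a * umul x) * dif (om0 b).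
Proof.
elim/tensor_ind: x => [|v w|x y IHx IHy|c x IHx].
- by rewrite !linear0 !mulr0 rmorph0 !mul0r addr0.
- rewrite bimod_pure !pi1_pure umul_pure [om0 (w * b)]rmorphM dif_iotaM mulrDr !rmorphM.
  by rewrite !mulrA.
- by rewrite !linearD /= IHx IHy !mulrDr !rmorphD !mulrDl addrACA.
- by rewrite !linearZ /= IHx -!pscaleAr !iotaZ -!pscaleAl scalerDr.
Qed.

Lemma umul_rop a b x c : umul x = c *: (1 : S7) ->
  umul (rop a b x) = ((a == b)%:R * c) *: (1 : S7).
Proof.
move=> ux; rewrite /rop linear_sum /=.
under eq_bigr => j _ do rewrite umul_bimod ux -pscaleAr mulr1 -pscaleAl.
by rewrite -scaler_sumr psi_orth mulrC -scalerA; case: (a == b); rewrite ?scale1r ?scale0r.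
Qed.

(** In the first term of [pi1_bimod] the form pi(x) moves out of
    <psi_a| ... |psi_b>, which leaves delta_ab; in the second one the scalar m(x)
    does, which leaves A_ab. *)
Lemma pi1_rop a b x c : umul x = c *: (1 : S7) -> central_form (pi1 x) ->
  pi1 (rop a b x) = (a == b)%:R *: pi1 x + c *: aform a b.
Proof.
move=> ux cx; rewrite /rop linear_sum /=.
under eq_bigr => j _ do
  rewrite pi1_bimod ux -[in X in _ + X]pscaleAr mulr1 iotaZ -[in X in _ + X]pscaleAl
    cx -mulrA -rmorphM.
rewrite big_split /= -mulr_sumr -rmorph_sum psi_orth -scaler_sumr; congr (_ + _).
by case: (a == b); rewrite ?rmorph1 ?rmorph0 ?mulr1 ?mulr0 ?scale1r ?scale0r.
Qed.

Lemma gen_dif_comm1 g : om0 (gen (s7bar g)) * dif (om0 (gen g)) =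
  dif (om0 (gen g)) * om0 (gen (s7bar g)).
Proof.
rewrite gen_dif_comm; case: g => i /=; by rewrite lambda'_same // scale1r.
Qed.

(** Once the differentials are moved to the right, this sum is the differential
    of the sphere relation. *)
Lemma aform_trace : aform 0 0 + aform 1 1 = 0.
Proof.
have : dif (om0 (\sum_i z i * zb i)) = 0 by rewrite sum_zzb rmorph1 dif1.
rewrite rmorph_sum linear_sum /= => <-.
have E (i : 'I_4) : dif (om0 (z i * zb i)) =
    om0 (zb i) * dif (om0 (z i)) + om0 (z i) * dif (om0 (zb i)).
  by rewrite rmorphM dif_iotaM -(gen_dif_comm1 (gz i)).
rewrite (eq_bigr _ (fun i _ => E i)) /aform !sum4.
have [s0 s1] := starpsiE; have [p0 p1] := psiE.
rewrite !s0 !s1 !p0 !p1 !(tnth_nth 0) /= !rmorphN !linearN /= !mulrNN.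
(* Reorder so that each dz_i stands next to its dzb_i. *)
by rewrite !addrA [LHS](ACl (1*6*5*2*3*8*7*4)).
Qed.

Lemma bimodNl a b x : bimod (- a) b x = - bimod a b x.
Proof. by rewrite -[- a]scaleN1r -[b in LHS]scale1r bimodZ mulr1 scaleN1r. Qed.

Lemma bimodNr a b x : bimod a (- b) x = - bimod a b x.
Proof. by rewrite -[- b]scaleN1r -[a in LHS]scale1r bimodZ mul1r scaleN1r. Qed.

Local Notation ell := (ell theta).

Lemma ell_rop : [/\ ell 1 = one2 theta,
    forall (k : int) m n, 0 <= k ->
      ell (rbas R (k + 1) m n) = rop 0 0 (ell (rbas R k m n)),
    forall (k : int) m n, k <= 0 ->
      ell (rbas R (k - 1) m n) = rop 1 1 (ell (rbas R k m n)),
    forall (k : int) m n,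
      ell (rbas R k m.+1 n) = rop 0 1 (ell (rbas R k m n)) &
    forall (k : int) m n,
      ell (rbas R k m n.+1) = rop 1 0 (ell (rbas R k m n))].
Proof.
have [e1 e2 e3 e4 e5] := ellP theta.
have [s0 s1] := starpsiE; have [p0 p1] := psiE.
have ropE a b x : rop a b x = bimod (star (psi a i1)) (psi b i1) x +
    bimod (star (psi a i2)) (psi b i2) x + bimod (star (psi a i3)) (psi b i3) x +
    bimod (star (psi a i4)) (psi b i4) x by rewrite /rop sum4.
split=> // k m n => [k0|k0||].
- by rewrite e2 // ropE !s0 !p0 !(tnth_nth 0) /= !bimodNl !bimodNr !opprK.
- by rewrite e3 // ropE !s1 !p1 !(tnth_nth 0) /=.
- by rewrite e4 // ropE !s0 !p1 !(tnth_nth 0) /= !bimodNl.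
- by rewrite e5 // ropE !s1 !p0 !(tnth_nth 0) /= !bimodNr.
Qed.

End Forms.

(** * The basis of the algebra of SU(2) *)

Section Basis.
Variable R : realType.
Local Notation w1 := (w1 R).
Local Notation w1b := (w1b R).
Local Notation w2 := (w2 R).
Local Notation w2b := (w2b R).
Local Notation rbas := (rbas R).

Lemma rbas1 : rbas 0 0 0 = 1.
Proof. by rewrite /rbas /= !expr0 scale1r !mulr1. Qed.

Lemma rbas_w1 (k : int) m n : 0 <= k -> rbas (k + 1) m n = w1 * rbas k m n.
Proof.
case: k => // a _; rewrite -PoszD addn1 /rbas exprS -pscaleAr.
by congr (_ *: _); ring.
Qed.

Lemma rbas_w1b (k : int) m n : k <= 0 -> rbas (k - 1) m n = w1b * rbas k m n.
Proof.
case: k => [[|//]|b] _; first by rewrite sub0r /rbas -pscaleAr;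
  congr (_ *: _); rewrite /= expr0; ring.
have -> : Negz b - 1 = Negz b.+1 by rewrite !NegzE -opprD -PoszD addn1.
by rewrite /rbas -pscaleAr [_ ^+ b.+2]exprS; congr (_ *: _); ring.
Qed.

Lemma rbas_w2 (k : int) m n : rbas k m.+1 n = w2 * rbas k m n.
Proof.
by case: k => a; rewrite /rbas -pscaleAr [_ ^+ m.+1]exprS; congr (_ *: _); ring.
Qed.

Lemma rbas_w2b (k : int) m n : rbas k m n.+1 = - w2b * rbas k m n.
Proof.
case: k => a; rewrite /rbas !exprS mulN1r scaleNr mulNr -pscaleAr;
  by congr (- (_ *: _)); ring.
Qed.

Lemma w1_w1b : w1 * w1b = 1 - w2 * w2b.
Proof. by rewrite -(su2_detE R) addrK. Qed.

(** Multiplying by w1 against the direction of the recursion brings in the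
    determinant relation, w1 w1b = 1 - w2 w2b. *)
Lemma rbas_w1_neg (k : int) m n : k < 0 ->
  w1 * rbas k m n = rbas (k + 1) m n + rbas (k + 1) m.+1 n.+1.
Proof.
move=> k0; have k1 : k + 1 <= 0 by rewrite lezD1.
rewrite -[in LHS](addrK 1 k) rbas_w1b // mulrA w1_w1b rbas_w2 rbas_w2b; ring.
Qed.

Lemma rbas_w1b_pos (k : int) m n : 0 < k ->
  w1b * rbas k m n = rbas (k - 1) m n + rbas (k - 1) m.+1 n.+1.
Proof.
move=> k0; have k1 : 0 <= k - 1 by rewrite subr_ge0.
rewrite -[in LHS](subrK 1 k) rbas_w1 // mulrA [w1b * _]mulrC w1_w1b rbas_w2 rbas_w2b; ring.
Qed.

(** The span of the basis, taken impredicatively as the set S below, contains 1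
    and is stable under multiplication by generators. *)
Lemma rbas_span (P : SU2 R -> Prop) :
    P 0 -> (forall x y, P x -> P y -> P (x + y)) ->
    (forall c x, P x -> P (c *: x)) -> (forall k m n, P (rbas k m n)) ->
  forall x, P x.
Proof.
move=> P0 PD PZ Pr x.
pose S y := forall Q : SU2 R -> Prop, Q 0 ->
  (forall x y, Q x -> Q y -> Q (x + y)) ->
  (forall c x, Q x -> Q (c *: x)) -> (forall k m n, Q (rbas k m n)) -> Q y.
have S0 : S 0 by move=> Q.
have SD u v : S u -> S v -> S (u + v).
  by move=> Su Sv Q q1 q2 q3 q4; apply: (q2); [exact: Su|exact: Sv].
have SZ c u : S u -> S (c *: u).
  by move=> Su Q q1 q2 q3 q4; apply: (q3); exact: Su.
have Sr k m n : S (rbas k m n) by move=> Q _ _ _; apply.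
have mulS t : (forall k m n, S (t * rbas k m n)) -> forall u, S u -> S (t * u).
  move=> St u Su; apply: (Su (fun u => S (t * u))) => //.
  - by rewrite mulr0.
  - by move=> a b Sa Sb; rewrite mulrDr; exact: SD.
  - by move=> c a Sa; rewrite -pscaleAr; exact: SZ.
suff St t : forall u, S u -> S (pclass (@su2rel R) t * u).
  have Sx : S x.
    rewrite -[x]mulr1 -rbas1; elim/palgW: x => t.
    exact: (St t _ (Sr 0 0%N 0%N)).
  exact: Sx.
elim: t => [g|c|s IHs t IHt|s IHs t IHt] u Su.
- apply: mulS Su => k m n; case: g.
  + have [k0|k0] := leP 0 k; first by have := Sr (k + 1) m n; rewrite rbas_w1.
    by have := SD _ _ (Sr (k + 1) m n) (Sr (k + 1) m.+1 n.+1); rewrite -rbas_w1_neg.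
  + have [k0|k0] := leP k 0; first by have := Sr (k - 1) m n; rewrite rbas_w1b.
    by have := SD _ _ (Sr (k - 1) m n) (Sr (k - 1) m.+1 n.+1); rewrite -rbas_w1b_pos.
  + by have := Sr k m.+1 n; rewrite rbas_w2.
  + have := SZ (-1) _ (Sr k m n.+1).
    by rewrite rbas_w2b scaleN1r mulNr opprK.
- exact: (SZ c _ Su).
- by rewrite pclassD mulrDl; apply: SD; [exact: IHs|exact: IHt].
- by rewrite pclassM -mulrA; apply: IHs; apply: IHt.
Qed.

(** The steps are those of the recursion that defines [ell]. *)
Lemma rbas_ind (P : SU2 R -> Prop) :
    P 1 ->
    (forall k m n, 0 <= k -> P (rbas k m n) -> P (rbas (k + 1) m n)) ->
    (forall k m n, k <= 0 -> P (rbas k m n) -> P (rbas (k - 1) m n)) ->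
    (forall k m n, P (rbas k m n) -> P (rbas k m.+1 n)) ->
    (forall k m n, P (rbas k m n) -> P (rbas k m n.+1)) ->
  forall k m n, P (rbas k m n).
Proof.
move=> P1 Pw1 Pw1b Pw2 Pw2b k m n.
have Pk : P (rbas k 0%N 0%N).
  elim/int_rect: k => [|j Pj|j Pj]; first by rewrite rbas1.
    by rewrite -addn1 PoszD; apply: Pw1.
  by rewrite -addn1 PoszD opprD; apply: Pw1b => //; rewrite oppr_le0.
elim: n => [|n Pn]; last exact: Pw2b.
by elim: m => // m Pm; apply: Pw2.
Qed.

Lemma eps0 : eps (0 : SU2 R) = 0.
Proof. exact: (eps_cst 0). Qed.
Lemma eps1 : eps (1 : SU2 R) = 1.
Proof. exact: (eps_cst 1). Qed.
Lemma eps_w1 : eps w1 = 1. Proof. exact: (eps_class (tgen gw1)). Qed.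
Lemma eps_w1b : eps w1b = 1. Proof. exact: (eps_class (tgen gw1b)). Qed.
Lemma eps_w2 : eps w2 = 0. Proof. exact: (eps_class (tgen gw2)). Qed.
Lemma eps_w2b : eps w2b = 0. Proof. exact: (eps_class (tgen gw2b)). Qed.
Lemma epsN (x : SU2 R) : eps (- x) = - eps x.
Proof. by rewrite -[- x]scaleN1r epsZ mulN1r. Qed.

Lemma eps_wmat (a b : 'I_2) : eps (wmat R a b) = (a == b)%:R.
Proof.
by elim/I2P: a; elim/I2P: b; rewrite mxE /= ?epsN ?eps_w1 ?eps_w1b ?eps_w2 ?eps_w2b ?oppr0.
Qed.

End Basis.

(** * The derivation induced by ell *)

Section Derivation.
Variables (R : realType) (theta : R).
Local Notation C := R[i].
Local Notation S7 := (S7 theta).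
Local Notation A2 := (tensor S7 S7).
Local Notation ell := (ell theta).
Local Notation umul := (@umul R theta).
Local Notation pi1 := (@pi1 R theta).
Local Notation rop := (@rop R theta).
Local Notation aform := (@aform R theta).
Local Notation central_form := (@central_form R theta).

Lemma umul_one2 : umul (one2 theta) = 1.
Proof. by rewrite umul_pure mulr1. Qed.

Lemma pi1_one2 : pi1 (one2 theta) = 0.
Proof. by rewrite pi1_pure rmorph1 dif1 mulr0. Qed.

Lemma umul_ell h : umul (ell h) = eps h *: (1 : S7).
Proof.
elim/rbas_span: h => [|x y Hx Hy|c x Hx|].
- by rewrite !linear0 eps0 scale0r.
- by rewrite !linearD /= Hx Hy epsD scalerDl.
- by rewrite !linearZ /= Hx epsZ scalerA.
have [e1 e2 e3 e4 e5] := ell_rop theta.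
apply: (rbas_ind (P := fun h => umul (ell h) = eps h *: (1 : S7)))
  => [|k m n k0 H|k m n k0 H|k m n H|k m n H].
- by rewrite e1 umul_one2 eps1 scale1r.
- by rewrite e2 // (umul_rop _ _ H) rbas_w1 // epsM eps_w1.
- by rewrite e3 // (umul_rop _ _ H) rbas_w1b // epsM eps_w1b.
- by rewrite e4 // (umul_rop _ _ H) rbas_w2 // epsM eps_w2.
- by rewrite e5 // (umul_rop _ _ H) rbas_w2b // [eps (- _ * _)]epsM epsN eps_w2b oppr0.
Qed.

(** The composite pi o ell; it differs from pi o omega by a multiple of
    pi(1 (x) 1) = 0. *)
Definition aell (h : SU2 R) : Om theta := pi1 (ell h).

Fact aell_linear : linear aell.
Proof. by move=> c x y; rewrite /aell !linearP. Qed.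
HB.instance Definition _ := GRing.isLinear.Build C (SU2 R) (Om theta) _ aell aell_linear.

Lemma aell1 : aell 1 = 0.
Proof. by rewrite /aell; have [-> _ _ _ _] := ell_rop theta; exact: pi1_one2. Qed.

Lemma central_aell_rbas k m n : central_form (aell (rbas R k m n)).
Proof.
have [e1 e2 e3 e4 e5] := ell_rop theta.
move: k m n.
have cr a b h : central_form (aell h) -> central_form (pi1 (rop a b (ell h))).
  move=> ch; rewrite (pi1_rop _ _ (umul_ell h) ch).
  by apply: central_formD; apply: central_formZ => //; exact: central_aform.
apply: (rbas_ind (P := fun h => central_form (aell h)))
  => [|k m n k0 H|k m n k0 H|k m n H|k m n H].
- rewrite aell1; exact: central_form0.
- by rewrite /aell e2 //; apply: cr.
- by rewrite /aell e3 //; apply: cr.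
- by rewrite /aell e4 //; apply: cr.
- by rewrite /aell e5 //; apply: cr.
Qed.

Lemma pi1_rop_rbas a b k m n : pi1 (rop a b (ell (rbas R k m n))) =
  (a == b)%:R *: aell (rbas R k m n) + eps (rbas R k m n) *: aform a b.
Proof. exact: pi1_rop (umul_ell _) (@central_aell_rbas k m n). Qed.

Lemma aell_w1 (k : int) m n : 0 <= k -> aell (rbas R (k + 1) m n) =
  aell (rbas R k m n) + eps (rbas R k m n) *: aform 0 0.
Proof.
move=> k0; have [_ e _ _ _] := ell_rop theta.
by rewrite {1}/aell e // pi1_rop_rbas scale1r.
Qed.

Lemma aell_w1b (k : int) m n : k <= 0 -> aell (rbas R (k - 1) m n) =
  aell (rbas R k m n) + eps (rbas R k m n) *: aform 1 1.
Proof.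
move=> k0; have [_ _ e _ _] := ell_rop theta.
by rewrite {1}/aell e // pi1_rop_rbas scale1r.
Qed.

Lemma aell_w2 k m n : aell (rbas R k m.+1 n) = eps (rbas R k m n) *: aform 0 1.
Proof.
have [_ _ _ e _] := ell_rop theta.
by rewrite {1}/aell e // pi1_rop_rbas scale0r add0r.
Qed.

Lemma aell_w2b k m n : aell (rbas R k m n.+1) = eps (rbas R k m n) *: aform 1 0.
Proof.
have [_ _ _ _ e] := ell_rop theta.
by rewrite {1}/aell e // pi1_rop_rbas scale0r add0r.
Qed.

Lemma aell_w2w2b k m n : aell (rbas R k m.+1 n.+1) = 0.
Proof. by rewrite aell_w2 rbas_w2b [eps (- _ * _)]epsM epsN eps_w2b oppr0 mul0r scale0r. Qed.

(** For w2 and w2b, and for w1 and w1b acting in the direction of the recursion,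
    this is [pi1_rop]. In the opposite direction w1 undoes a step with w1b: the
    w2 w2b term of the determinant relation is killed, and the required A_11
    is minus the A_22 of the undone step. *)
Lemma aell_wmat a b h :
  aell (wmat R a b * h) = (a == b)%:R *: aell h + eps h *: aform a b.
Proof.
elim/rbas_span: h => [|x y Hx Hy|c x Hx|k m n].
- by rewrite mulr0 !linear0 eps0 scale0r addr0.
- by rewrite mulrDr !linearD /= Hx Hy epsD scalerDl addrACA.
- by rewrite -pscaleAr !linearZ /= Hx epsZ !scalerDr !scalerA mulrC.
have tr : aform 0 0 = - aform 1 1.
  by apply/eqP; rewrite -addr_eq0; apply/eqP/aform_trace.
elim/I2P: a; elim/I2P: b; rewrite mxE /= ?scale1r ?scale0r ?add0r.
- have [k0|k0] := leP 0 k; first by rewrite -rbas_w1 ?aell_w1.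
  have k1 : k + 1 <= 0 by rewrite lezD1.
  rewrite rbas_w1_neg // linearD /= aell_w2w2b addr0.
  have kE : k = k + 1 - 1 by rewrite addrK.
  rewrite [in RHS]kE aell_w1b // rbas_w1b // epsM eps_w1b mul1r tr scalerN addrK.
  by [].
- by rewrite -rbas_w2 aell_w2.
- by rewrite -rbas_w2b aell_w2b.
- have [k0|k0] := leP k 0; first by rewrite -rbas_w1b ?aell_w1b.
  have k1 : 0 <= k - 1 by rewrite subr_ge0.
  rewrite rbas_w1b_pos // linearD /= aell_w2w2b addr0.
  have kE : k = k - 1 + 1 by rewrite subrK.
  by rewrite [in RHS]kE aell_w1 // rbas_w1 // epsM eps_w1 mul1r tr scalerN subrK.
Qed.

End Derivation.

(** * Words and tensor powers *)

Section Words.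
Variables (T : finType) (n : nat).

Definition ffrcons (J : {ffun 'I_n -> T}) (j : T) : {ffun 'I_n.+1 -> T} :=
  [ffun s => if unlift ord_max s is Some s' then J s' else j].

Lemma widen_lift (s : 'I_n) : widen_ord (leqnSn n) s = lift ord_max s.
Proof. by apply: val_inj; exact: esym (lift_max s). Qed.

Lemma ffrcons_widen J j s : ffrcons J j (widen_ord (leqnSn n) s) = J s.
Proof. by rewrite ffunE widen_lift liftK. Qed.

Lemma ffrcons_max J j : ffrcons J j ord_max = j.
Proof. by rewrite ffunE unlift_none. Qed.

Lemma sum_ffrcons (V : nmodType) (F : {ffun 'I_n.+1 -> T} -> V) :
  \sum_J F J = \sum_j \sum_J F (ffrcons J j).
Proof.
rewrite pair_bigA /= (reindex (fun p : T * {ffun 'I_n -> T} => ffrcons p.2 p.1)) //.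
apply: onW_bij.
exists (fun J : {ffun 'I_n.+1 -> T} =>
    (J ord_max, [ffun s : 'I_n => J (widen_ord (leqnSn n) s)])) => [[j J]|J] /=.
  by rewrite ffrcons_max; congr pair; apply/ffunP=> s; rewrite ffunE ffrcons_widen.
apply/ffunP=> s; rewrite ffunE; case: unliftP => [s'|] -> //.
by rewrite ffunE widen_lift.
Qed.

End Words.

(** * The orthonormal basis of the symmetric power *)

Section SymmetricBasis.
Variables (R : realType) (n : nat).
Local Notation C := R[i].

Definition word_of_set (S : {set 'I_n}) : {ffun 'I_n -> 'I_2} :=
  [ffun s => if s \in S then 1 else 0].

Lemma word_of_setK : cancel word_of_set (fun I => [set s | I s == 1]).
Proof. by move=> S; apply/setP=> s; rewrite inE ffunE; case: (s \in S). Qed.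

Lemma word_of_set_bij : bijective word_of_set.
Proof.
exists (fun I : {ffun 'I_n -> 'I_2} => [set s | I s == 1]); first exact: word_of_setK.
by move=> I; apply/ffunP=> s; rewrite ffunE inE; elim/I2P: (I s).
Qed.

Lemma ebas_word k S :
  ebas R k (word_of_set S) = if #|S| == k then ((anorm R n k)^-1)%:C%C else 0.
Proof. by rewrite ebasE /= word_of_setK. Qed.

(** The vector e_k is supported, with constant value, on the words that have
    exactly k letters 1; such a word is given by the set of their positions. *)
Lemma sum_ebas (V : lmodType C) k (F : {ffun 'I_n -> 'I_2} -> V) :
  \sum_I ebas R k I *: F I =
  ((anorm R n k)^-1)%:C%C *: \sum_(S : {set 'I_n} | #|S| == k) F (word_of_set S).
Proof.
rewrite (reindex _ (onW_bij _ word_of_set_bij)) /= scaler_sumr [RHS]big_mkcond /=.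
by apply: eq_bigr => S _; rewrite ebas_word; case: eqP => _; rewrite ?scale0r.
Qed.

Lemma ebas_orthonormal (k l : 'I_n.+1) :
  \sum_(I : {ffun 'I_n -> 'I_2}) ebas R k I * ebas R l I = (k == l)%:R.
Proof.
rewrite (sum_ebas (V := C^o) k (@ebas R n l)).
have [->|kl] := eqVneq k l; last first.
  rewrite big1 ?scaler0 // => S /eqP Sk; rewrite ebas_word Sk ifN //.
rewrite (eq_bigr (fun=> ((anorm R n l)^-1)%:C%C)); last by move=> S Sl; rewrite ebas_word Sl.
rewrite sumr_const -[X in _ *+ X]cardsE card_draws card_ord.
have ln : (l <= n)%N by rewrite -ltnS.
have aK : (anorm R n l)^-1 * ((anorm R n l)^-1 *+ 'C(n, l)) = 1.
  rewrite -mulr_natr -[X in _ * (_ * X)]sqr_sqrtr ?ler0n // -/(anorm R n l).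
  by rewrite expr2 mulKf ?anorm_neq0 // mulVf ?anorm_neq0.
transitivity (real_complex R ((anorm R n l)^-1 * ((anorm R n l)^-1 *+ 'C(n, l)))).
  by rewrite rmorphM rmorphMn.
by rewrite aK rmorph1.
Qed.

Lemma ebas_conj k I : (ebas R (n := n) k I)^* = ebas R k I.
Proof. by rewrite ebasE; case: ifP => _; [exact: conjc_real|exact: rmorph0]. Qed.

End SymmetricBasis.

(** * The connection form on words *)

Section Kets.
Variables (R : realType) (theta : R).
Local Notation C := R[i].
Local Notation S7 := (S7 theta).
Local Notation A2 := (tensor S7 S7).
Local Notation umul := (@umul R theta).
Local Notation pi1 := (@pi1 R theta).
Local Notation star := (@star R theta).
Local Notation psi := (psi theta).
Local Notation aell := (aell theta).

(** The components of psi_(I 0) (x) ... (x) psi_(I (n - 1)). *)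
Definition psiw n (I : 'I_n -> 'I_2) (J : 'I_n -> 'I_4) : S7 :=
  \prod_(s < n) psi (I s) (J s).

(** The tensor that pi sends to <Psi_I|d Psi_I'>. *)
Definition ketbra n (I I' : 'I_n -> 'I_2) : A2 :=
  \sum_(J : {ffun 'I_n -> 'I_4}) pure (star (psiw I J)) (psiw I' J).

Definition wword n (I I' : 'I_n -> 'I_2) : SU2 R := \prod_(s < n) wmat R (I s) (I' s).

Lemma phi_psiw n k J :
  phi theta (n := n) k J = \sum_(I : {ffun 'I_n -> 'I_2}) ebas R k I *: psiw I J.
Proof.
rewrite sum_ebas /phi /symt; congr (_ *: _); apply: eq_bigr => S _.
by apply: eq_bigr => s _; rewrite ffunE; case: (s \in S).
Qed.

Lemma ketbra0 (I I' : 'I_0 -> 'I_2) : ketbra I I' = one2 theta.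
Proof.
have J0 (J J' : {ffun 'I_0 -> 'I_4}) : J = J' by apply/ffunP => -[].
pose J1 : {ffun 'I_0 -> 'I_4} := [ffun=> i1].
rewrite /ketbra (big_pred1 J1) => [|J]; last by rewrite /= (J0 J J1) eqxx.
by rewrite /psiw !big_ord0 star1.
Qed.

(** The involution reverses products, so the last letter becomes the outermost
    factor on both sides of the tensor. *)
Lemma ketbraS n (I I' : 'I_n.+1 -> 'I_2) :
  ketbra I I' = rop (I ord_max) (I' ord_max)
    (ketbra (I \o widen_ord (leqnSn n)) (I' \o widen_ord (leqnSn n))).
Proof.
rewrite /ketbra sum_ffrcons /rop; apply: eq_bigr => j _.
rewrite linear_sum; apply: eq_bigr => J _ /=; rewrite bimod_pure.
have E K : psiw K (ffrcons J j) =
    psiw (K \o widen_ord (leqnSn n)) J * psi (K ord_max) j.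
  rewrite /psiw big_ord_recr /= ffrcons_max; congr (_ * _).
  by apply: eq_bigr => s _; rewrite ffrcons_widen.
by rewrite !E starM.
Qed.

(** The three properties are carried along together, because [pi1_rop] for the
    next letter requires a scalar product and a central form. *)
Lemma ketbra_word n (I I' : 'I_n -> 'I_2) :
  [/\ umul (ketbra I I') = eps (wword I I') *: (1 : S7),
      pi1 (ketbra I I') = aell (wword I I') &
      central_form (pi1 (ketbra I I'))].
Proof.
elim: n I I' => [|n IHn] I I'.
  rewrite ketbra0 /wword big_ord0 pi1_one2 umul_one2 eps1 scale1r aell1.
  by split=> //; exact: central_form0.
have [u p c] := IHn (I \o widen_ord (leqnSn n)) (I' \o widen_ord (leqnSn n)).
have -> : wword I I' = wmat R (I ord_max) (I' ord_max) *
    wword (I \o widen_ord (leqnSn n)) (I' \o widen_ord (leqnSn n)).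
  by rewrite /wword big_ord_recr mulrC.
have pE := pi1_rop (I ord_max) (I' ord_max) u c.
rewrite ketbraS (umul_rop _ _ u) epsM eps_wmat aell_wmat pE p; split=> //.
apply: central_formD; apply: central_formZ; last exact: central_aform.
by rewrite -p.
Qed.

Lemma conn_form_words n (k l : 'I_n.+1) : conn_form theta k l =
  \sum_(I : {ffun 'I_n -> 'I_2}) \sum_(I' : {ffun 'I_n -> 'I_2})
    (ebas R k I * ebas R l I') *: aell (wword I I').
Proof.
have star_sum (r : seq {ffun 'I_n -> 'I_2}) F :
    star (\sum_(I <- r) F I) = \sum_(I <- r) star (F I).
  exact: (big_morph star (@starD _ theta) (star0 theta)).
rewrite /conn_form /braket_d.
transitivity (\sum_(J : {ffun 'I_n -> 'I_4})
    \sum_(I : {ffun 'I_n -> 'I_2}) \sum_(I' : {ffun 'I_n -> 'I_2})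
    (ebas R k I * ebas R l I') *: pi1 (pure (star (psiw I J)) (psiw I' J))).
  apply: eq_bigr => J _; rewrite !phi_psiw star_sum !rmorph_sum linear_sum mulr_suml /=.
  apply: eq_bigr => I _; rewrite mulr_sumr; apply: eq_bigr => I' _.
  rewrite starZ ebas_conj !iotaZ linearZ /= -pscaleAl -pscaleAr scalerA pi1_pure.
  by [].
rewrite exchange_big; apply: eq_bigr => I _ /=.
rewrite exchange_big; apply: eq_bigr => I' _ /=.
rewrite -scaler_sumr -linear_sum /=; congr (_ *: _).
by have [_ <- _] := ketbra_word I I'.
Qed.

(** Pairing the defining relation of the matrix coefficients with e_k isolates
    the (k, l) coefficient. *)
Lemma aell_rho_coef n (k l : 'I_n.+1) : aell (rho_coef R n k l) =
  \sum_(I : {ffun 'I_n -> 'I_2}) \sum_(I' : {ffun 'I_n -> 'I_2})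
    (ebas R k I * ebas R l I') *: aell (wword I I').
Proof.
transitivity (\sum_(I : {ffun 'I_n -> 'I_2}) ebas R k I *: aell (rho (ebas R l) I)).
  under eq_bigr => I _ do rewrite rho_coefP linear_sum scaler_sumr /=.
  rewrite exchange_big (bigD1 k) //= [X in _ + X]big1 => [|k' k'k].
    under eq_bigr => I _ do rewrite linearZ /= scalerA.
    by rewrite -scaler_suml ebas_orthonormal eqxx scale1r addr0.
  under eq_bigr => I _ do rewrite linearZ /= scalerA.
  by rewrite -scaler_suml ebas_orthonormal eq_sym (negPf k'k) scale0r.
apply: eq_bigr => I _; rewrite linear_sum scaler_sumr.
by apply: eq_bigr => I' _; rewrite linearZ /= scalerA.
Qed.

End Kets.

Theorem mainTheorem7 (R : realType) (theta : R) (n : nat) (hn : (0 < n)%N) :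
  (forall h : SU2 R, omega theta h \in @Omega1un R theta) /\
  (forall k l : 'I_n.+1,
     pi1 (omega theta (rho_coef R n k l)) = conn_form theta k l).
Proof.
split=> [h|k l].
  rewrite unfold_in /omega linearB linearZ /= umul_ell umul_one2.
  by rewrite subrr.
rewrite /omega linearB linearZ /= pi1_one2 scaler0 subr0.
by rewrite conn_form_words -aell_rho_coef.
Qed.
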